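(* Let $n\ge 3$ be an integer and let $\beta\in(0,1)$. Then the potential $U_\beta$ has a non-trivial critical point on each perpendicular bisector to the sides of the regular $n$-gon, and a critical point at the origin. Furthermore, each non-trivial critical point of $U_\beta$, with polar coordinates $(r,\theta)$, satisfies $$r\in\bigl(r_l(n,\beta),\,r_u(n)\bigr),\qquad\text{where}\qquad r_l(n,\beta)=\left(\frac{\beta}{\beta+n}\right)^{\frac1{n-2}},\quad r_u(n)=\cos(\pi/n).$$
   Context: Positive unit point charges are placed at the vertices $\zeta_n^j=e^{2\pi i j/n}$, $j=1,\dots,n$, of a regular $n$-gon inscribed in the unit circle. For $z=re^{i\theta}$ with $r\in[0,1)$, $\theta\in[0,2\pi)$, the Riesz potential is $$U_\beta(r,\theta)=\sum_{j=1}^n|z-\zeta_n^j|^{-2\beta}=\sum_{j=1}^n\frac{1}{(1+r^2-2r\cos(2\pi j/n-\theta))^{\beta}}.$$ It is regarded as a smooth function on the open unit disc in $\mathbb{R}^2\cong\mathbb{C}$; a critical point is a point of the open unit disc where its gradient vanishes. A critical point is called non-trivial if it is different from the origin. The perpendicular bisectors to the sides of the polygon are understood as the rays from the origin $\theta=\pi k/n$, $k=1,3,5,\dots,2n-1$. *)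

(* Defs.v *)
From Stdlib Require Import Reals Arith.
From Coquelicot Require Import Coquelicot.
Open Scope R_scope.

(* The plane is Coquelicot's [C], i.e. [R * R]: [z] is the pair [(Re z, Im z)]. *)

Definition polar (r theta : R) : C := (r * cos theta, r * sin theta).

Definition vertex (n j : nat) : C := polar 1 (2 * PI * INR j / INR n).

(* [Rpower x y] is [x] to the real power [y] only for [0 < x]; this is the case
   for every term as soon as [z] is not a vertex, in particular on the open
   unit disc. *)
Definition riesz_potential (n : nat) (beta : R) (z : C) : R :=
  sum_n_m (fun j => Rpower (Cmod (z - vertex n j)%C) (- 2 * beta)) 1 n.

(* The Cartesian gradient, encoded as a complex number; with [is_derive] (rather
   than the total [Derive]) existence of the partial derivatives is included. *)
Definition is_gradient (f : C -> R) (z g : C) : Prop :=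
  is_derive (fun x : R => f (x, Im z)) (Re z) (Re g) /\
  is_derive (fun y : R => f (Re z, y)) (Im z) (Im g).

Definition critical_point (f : C -> R) (z : C) : Prop :=
  Cmod z < 1 /\ is_gradient f z (RtoC 0).

Definition nontrivial_critical_point (f : C -> R) (z : C) : Prop :=
  critical_point f z /\ z <> RtoC 0.

Definition on_ray (theta : R) (z : C) : Prop :=
  exists r : R, 0 <= r /\ z = polar r theta.

Definition r_l (n : nat) (beta : R) : R :=
  Rpower (beta / (beta + INR n)) (1 / (INR n - 2)).

Definition r_u (n : nat) : R := cos (PI / INR n).

(* Main.v *)
(* Put [phi_j = theta - 2 pi j / n] and [a_j = 1 + r^2 - 2 r cos phi_j].  Since
   [a^(-beta) = const * ∫_0^∞ x^(-beta) / (x + a) dx] and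
   [x + a_j = (1 - 2 r t cos phi_j + r^2 t^2) / t] for
   [x = (1 - t) (1 - r^2 t) / t], the potential is
     [const * ∫_0^1 x^(-beta) * (sum of the Poisson kernels at radius r t) dt / t],
   and the sum of the [n] Poisson kernels is [n] times the Poisson kernel at
   radius [(r t)^n] and angle [n theta].  Hence the angular derivative has the
   sign of [- sin (n theta)], and critical points lie on the rays
   [cos (n theta) = 1] or [cos (n theta) = -1].  On the former the integrand
   increases with [r]; on the latter, the bisectors, it does so as long as
   [n r^(n-2) <= beta], which holds for [r <= r_l].  On a bisector all
   [cos phi_j <= cos (pi / n)], so the potential decreases with [r] beyond
   [r_u], and the intermediate value theorem gives a critical point.

   Nothing is differentiated under the integral sign: the improper integrals are
   limits of the primitive [stieltjes_primitive], and signs are obtained from the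
   monotonicity in [t] of combinations of it. *)
Require Import Defs.
From Stdlib Require Import Reals Arith Lra Lia.
From Coquelicot Require Import Coquelicot.
Open Scope R_scope.

(* [ring] and [field] do not see through the carriers of Coquelicot's
   algebraic structures, which the sums leave in the type of equalities. *)
Ltac as_real := match goal with |- ?a = ?b => change (@eq R a b) end.
Ltac as_complex := match goal with |- ?a = ?b => change (@eq C a b) end.

(** * Sums of Poisson kernels over the vertices *)

Lemma sum_n_m_Rmult_l (a : R) (u : nat -> R) (m n : nat) :
  sum_n_m (fun k => a * u k) m n = a * sum_n_m u m n.
Proof. apply (sum_n_m_mult_l (K := R_Ring)). Qed.

Lemma sum_n_m_Rplus (u v : nat -> R) (m n : nat) :
  sum_n_m (fun k => u k + v k) m n = sum_n_m u m n + sum_n_m v m n.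
Proof. apply (sum_n_m_plus (G := R_AbelianMonoid)). Qed.

Lemma is_derive_sum_n_m (f : nat -> R -> R) (d : nat -> R) (m n : nat) (x : R) :
  (forall k, (m <= k <= n)%nat -> is_derive (f k) x (d k)) ->
  is_derive (fun y => sum_n_m (fun k => f k y) m n) x (sum_n_m d m n).
Proof.
  induction n as [|n IH]; intros H.
  - destruct m as [|m].
    + rewrite sum_n_n.
      apply (is_derive_ext (f 0%nat)); [intros; now rewrite sum_n_n | apply H; lia].
    + rewrite sum_n_m_zero by lia.
      apply (is_derive_ext (fun _ => zero)).
      { intros; now rewrite sum_n_m_zero by lia. }
      apply @is_derive_const.
  - destruct (le_lt_dec m (S n)) as [Hm|Hm].
    + rewrite sum_n_Sm by lia.
      apply (is_derive_ext (fun y => plus (sum_n_m (fun k => f k y) m n) (f (S n) y))).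
      { intros; now rewrite sum_n_Sm by lia. }
      apply @is_derive_plus; [apply IH; intros; apply H; lia | apply H; lia].
    + rewrite sum_n_m_zero by lia.
      apply (is_derive_ext (fun _ => zero)).
      { intros; now rewrite sum_n_m_zero by lia. }
      apply @is_derive_const.
Qed.

Lemma polar_mult (a b x y : R) : (polar a x * polar b y)%C = polar (a * b) (x + y).
Proof.
  unfold polar, Cmult; simpl. rewrite cos_plus, sin_plus. f_equal; ring.
Qed.

Lemma polar_pow (a x : R) (k : nat) : (polar a x ^ k)%C = polar (a ^ k) (INR k * x).
Proof.
  induction k as [|k IH].
  - unfold polar; simpl. rewrite Rmult_0_l, cos_0, sin_0.
    unfold RtoC; f_equal; ring.
  - rewrite Cpow_S, IH, polar_mult, S_INR. f_equal; simpl; ring.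
Qed.

Lemma cos_sub_period (x : R) (k : nat) : cos (x - 2 * PI * INR k) = cos x.
Proof.
  rewrite <- (cos_period (x - 2 * PI * INR k) k). f_equal; ring.
Qed.

Lemma sin_sub_period (x : R) (k : nat) : sin (x - 2 * PI * INR k) = sin x.
Proof.
  rewrite <- (sin_period (x - 2 * PI * INR k) k). f_equal; ring.
Qed.

Lemma polar_sub_period (a x : R) (k : nat) : polar a (x - 2 * PI * INR k) = polar a x.
Proof. unfold polar; now rewrite cos_sub_period, sin_sub_period. Qed.

Definition vertex_angle (n : nat) (theta : R) (j : nat) : R :=
  theta - 2 * PI * INR j / INR n.

Lemma mult_vertex_angle (n : nat) (theta : R) (j : nat) :
  (0 < n)%nat ->
  INR n * vertex_angle n theta j = INR n * theta - 2 * PI * INR j.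
Proof.
  intros Hn. unfold vertex_angle. field. apply not_0_INR; lia.
Qed.

Lemma geometric_sum_from_1 (u : C) (n : nat) :
  ((u - 1) * sum_n_m (fun j => u ^ j)%C 1 n = u ^ S n - u)%C.
Proof.
  induction n as [|n IH].
  - rewrite sum_n_m_zero by lia. change zero with (RtoC 0). simpl. ring.
  - rewrite sum_n_Sm by lia. change plus with Cplus.
    rewrite Cmult_plus_distr_l, IH. rewrite !Cpow_S. ring.
Qed.

Lemma cos_lt_1 (x : R) : 0 < x < 2 * PI -> cos x < 1.
Proof.
  intros Hx. replace x with (2 * (x / 2)) by field. rewrite cos_2a_sin.
  assert (0 < sin (x / 2)) by (apply sin_gt_0; lra). nra.
Qed.

(** The terms form a geometric progression whose ratio [u] is an [n]-th root of unity; [0 < k < n]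
    gives [u <> 1], so a full period sums to zero. *)
Lemma sum_vertex_powers (n : nat) (rho theta : R) (k : nat) :
  (0 < k < n)%nat ->
  sum_n_m (fun j => polar rho (vertex_angle n theta j) ^ k)%C 1 n = RtoC 0.
Proof.
  intros Hk.
  assert (Hn : 0 < INR n) by (apply lt_0_INR; lia).
  assert (Hk0 : 0 < INR k) by (apply lt_0_INR; lia).
  assert (Hkn : INR k < INR n) by (apply lt_INR; lia).
  set (u := polar 1 (- (2 * PI * INR k / INR n))).
  rewrite (sum_n_m_ext _ (fun j => mult (polar (rho ^ k) (INR k * theta)) (u ^ j)%C)).
  2:{ intros j. change mult with Cmult. unfold u.
      rewrite !polar_pow, polar_mult, pow1. unfold vertex_angle.
      f_equal; field; lra. }
  rewrite @sum_n_m_mult_l. change mult with Cmult.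
  assert (Hu : (u ^ n)%C = RtoC 1).
  { unfold u. rewrite polar_pow, pow1.
    replace (INR n * - (2 * PI * INR k / INR n)) with (0 - 2 * PI * INR k) by (field; lra).
    rewrite polar_sub_period. unfold polar. rewrite cos_0, sin_0.
    unfold RtoC; f_equal; ring. }
  assert (Hu1 : (u - 1)%C <> RtoC 0).
  { intros E. apply (f_equal fst) in E. revert E. unfold u, polar; simpl.
    rewrite cos_neg.
    assert (cos (2 * PI * INR k / INR n) < 1); [|lra].
    apply cos_lt_1. pose proof PI_RGT_0 as HPI.
    assert (0 < INR k / INR n) by (apply Rdiv_lt_0_compat; lra).
    assert (INR k / INR n < 1) by (apply Rlt_div_l; lra).
    replace (2 * PI * INR k / INR n) with (2 * PI * (INR k / INR n)) by (field; lra).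
    nra. }
  assert (Hs : sum_n_m (fun j => u ^ j)%C 1 n = RtoC 0).
  { pose proof (geometric_sum_from_1 u n) as G.
    rewrite Cpow_S, Hu in G.
    replace (u * 1 - u)%C with (RtoC 0) in G by ring.
    apply (f_equal (fun z => (/ (u - 1) * z)%C)) in G.
    rewrite Cmult_assoc, Cinv_l, Cmult_1_l, Cmult_0_r in G by exact Hu1. exact G. }
  change (@sum_n_m C_Ring) with (@sum_n_m C_AbelianMonoid) in *.
  etransitivity; [apply f_equal, Hs | apply Cmult_0_r].
Qed.

(** After exchanging the sums only the power [k = 0] survives, and it contributes [1] for each
    vertex. *)
Lemma sum_vertex_geometric (n : nat) (rho theta : R) (m : nat) :
  (m < n)%nat ->
  sum_n_m (fun j => sum_n (fun k => polar rho (vertex_angle n theta j) ^ k)%C m) 1 n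
  = RtoC (INR n).
Proof.
  induction m as [|m IH]; intros Hm.
  - rewrite (sum_n_m_ext _ (fun _ => RtoC 1)).
    2:{ intros j. rewrite sum_O. reflexivity. }
    clear Hm. induction n as [|n IH].
    + now rewrite sum_n_m_zero by lia.
    + rewrite sum_n_Sm by lia. rewrite IH, S_INR. now rewrite RtoC_plus.
  - rewrite (sum_n_m_ext _ (fun j => plus
      (sum_n (fun k => polar rho (vertex_angle n theta j) ^ k)%C m)
      (polar rho (vertex_angle n theta j) ^ S m)%C)).
    2:{ intros j. apply sum_Sn. }
    rewrite sum_n_m_plus, IH by lia.
    rewrite sum_vertex_powers by lia. change plus with Cplus. apply Cplus_0_r.
Qed.

(* The squared distance between [polar r x] and [1]. *)
Definition sqdist (r x : R) : R := 1 - 2 * r * cos x + r ^ 2.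

Lemma sqdist_pos (rho x : R) :
  0 <= rho < 1 -> 0 < sqdist rho x.
Proof.
  intros H. unfold sqdist. pose proof (COS_bound x). nra.
Qed.

Lemma polar_neq_1 (rho x : R) : 0 <= rho < 1 -> (1 - polar rho x)%C <> RtoC 0.
Proof.
  intros H E. apply (f_equal fst) in E. revert E. unfold polar; simpl.
  pose proof (COS_bound x). nra.
Qed.

Lemma geometric_sum (w : C) (m : nat) :
  ((1 - w) * sum_n (fun k => w ^ k)%C m = 1 - w ^ S m)%C.
Proof.
  induction m as [|m IH].
  - rewrite sum_O. simpl. ring.
  - rewrite sum_Sn. change plus with Cplus.
    rewrite Cmult_plus_distr_l, IH. rewrite !Cpow_S. ring.
Qed.

(** Write [1 / (1 - w) = (1 + w + ... + w^(n-1)) / (1 - w^n)]. The power [w^n] is the same for all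
    vertices, so the denominator factors out of the sum. *)
Lemma sum_cauchy_kernel (n : nat) (rho theta : R) :
  (0 < n)%nat -> 0 <= rho < 1 ->
  sum_n_m (fun j => / (1 - polar rho (vertex_angle n theta j)))%C 1 n
  = (RtoC (INR n) / (1 - polar (rho ^ n) (INR n * theta)))%C.
Proof.
  intros Hn Hr.
  assert (Hrn : 0 <= rho ^ n < 1).
  { split; [apply pow_le; lra | apply pow_lt_1_compat; [lra | lia]]. }
  rewrite (sum_n_m_ext _ (fun j => mult (/ (1 - polar (rho ^ n) (INR n * theta)))%C
     (sum_n (fun k => polar rho (vertex_angle n theta j) ^ k)%C (n - 1)))).
  2:{ intros j. change mult with Cmult.
      pose proof (geometric_sum (polar rho (vertex_angle n theta j)) (n - 1)) as G.
      replace (S (n - 1)) with n in G by lia.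
      rewrite polar_pow, mult_vertex_angle, polar_sub_period in G by lia.
      set (w := polar rho _) in *.
      assert (Hw : (1 - w)%C <> RtoC 0) by apply (polar_neq_1 _ _ Hr).
      assert (HW : (1 - polar (rho ^ n) (INR n * theta))%C <> RtoC 0)
        by apply (polar_neq_1 _ _ Hrn).
      change (@sum_n C_Ring) with (@sum_n C_AbelianMonoid).
      set (s := @sum_n C_AbelianMonoid _ _) in *. clearbody s w.
      transitivity (/ (1 - polar (rho ^ n) (INR n * theta)) * (/ (1 - w) * ((1 - w) * s)))%C.
      - rewrite G. as_complex. field. now split.
      - apply (f_equal (Cmult _)). now rewrite Cmult_assoc, Cinv_l, Cmult_1_l by exact Hw. }
  rewrite @sum_n_m_mult_l. change mult with Cmult.
  unfold Cdiv. rewrite Cmult_comm. f_equal.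
  apply sum_vertex_geometric; lia.
Qed.

(** The Poisson kernel is [(1 - rho^2) / sqdist rho x]; this passes from the Cauchy kernel to it. *)
Lemma Re_cauchy_kernel (rho x : R) : 0 <= rho < 1 ->
  Re (/ (1 - polar rho x))%C = (1 + (1 - rho ^ 2) / sqdist rho x) / 2.
Proof.
  intros H. pose proof (sqdist_pos rho x H) as HD.
  assert (E : (1 - rho * cos x) ^ 2 + (rho * sin x) ^ 2 = sqdist rho x).
  { pose proof (sin2_cos2 x) as S; unfold Rsqr in S. unfold sqdist. nra. }
  unfold Re, Cinv, polar; cbn [fst snd Cminus Cplus Copp RtoC].
  replace ((1 + - (rho * cos x)) ^ 2 + (0 + - (rho * sin x)) ^ 2)
    with (sqdist rho x) by (rewrite <- E; ring).
  unfold sqdist in *. field. lra.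
Qed.

Lemma Re_sum_n_m (f : nat -> C) (m n : nat) :
  Re (sum_n_m f m n) = sum_n_m (fun j => Re (f j)) m n.
Proof.
  induction n as [|n IH].
  - destruct m; [now rewrite !sum_n_n | now rewrite !sum_n_m_zero by lia].
  - destruct (le_lt_dec m (S n)).
    + rewrite !sum_n_Sm by lia. now rewrite <- IH.
    + now rewrite !sum_n_m_zero by lia.
Qed.

(** Real part of [sum_cauchy_kernel]: the constants [1/2] add up to [n/2] on both sides and
    cancel. *)
Lemma sum_poisson_kernel (n : nat) (rho theta : R) :
  (0 < n)%nat -> 0 <= rho < 1 ->
  sum_n_m (fun j => / sqdist rho (vertex_angle n theta j)) 1 n
  = INR n * (1 - (rho ^ n) ^ 2) / (1 - rho ^ 2) /
    sqdist (rho ^ n) (INR n * theta).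
Proof.
  intros Hn Hr.
  assert (Hrn : 0 <= rho ^ n < 1).
  { split; [apply pow_le; lra | apply pow_lt_1_compat; [lra | lia]]. }
  pose proof (f_equal Re (sum_cauchy_kernel n rho theta Hn Hr)) as E.
  rewrite Re_sum_n_m in E.
  rewrite (sum_n_m_ext _ (fun j => / 2 + (1 - rho ^ 2) / 2 *
     / sqdist rho (vertex_angle n theta j))) in E.
  2:{ intros j. rewrite Re_cauchy_kernel by exact Hr.
      as_real. field.
      pose proof (sqdist_pos rho (vertex_angle n theta j) Hr); lra. }
  rewrite sum_n_m_Rplus, sum_n_m_Rmult_l, sum_n_m_const in E.
  replace (S n - 1)%nat with n in E by lia.
  replace (Re (RtoC (INR n) / (1 - polar (rho ^ n) (INR n * theta)))%C)
    with (INR n * Re (/ (1 - polar (rho ^ n) (INR n * theta)))%C) in E.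
  2:{ unfold Cdiv. generalize (/ (1 - polar (rho ^ n) (INR n * theta)))%C. intros z.
      unfold Re, RtoC, Cmult; simpl; ring. }
  rewrite Re_cauchy_kernel in E by exact Hrn.
  pose proof (sqdist_pos (rho ^ n) (INR n * theta) Hrn) as HE.
  assert (H1 : 0 < 1 - rho ^ 2) by nra.
  set (X := sum_n_m _ 1 n : R) in *.
  set (EE := sqdist (rho ^ n) (INR n * theta)) in *.
  clearbody X.

  as_real. transitivity (2 / (1 - rho ^ 2) * ((1 - rho ^ 2) / 2 * X)); [field; lra|].
  replace ((1 - rho ^ 2) / 2 * X)
    with (INR n * ((1 + (1 - (rho ^ n) ^ 2) / EE) / 2) - INR n * / 2) by (rewrite <- E; ring).
  field. lra.
Qed.

(** Both sides of [sum_poisson_kernel] are differentiated in [theta], which raises the exponent of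
    [sqdist] to 2; uniqueness of the derivative gives the identity. *)
Lemma sum_sin_poisson_kernel (n : nat) (rho theta : R) :
  (0 < n)%nat -> 0 < rho < 1 ->
  rho * sum_n_m (fun j => sin (vertex_angle n theta j) /
     sqdist rho (vertex_angle n theta j) ^ 2) 1 n
  = INR n ^ 2 * rho ^ n * (1 - (rho ^ n) ^ 2) / (1 - rho ^ 2) * sin (INR n * theta) /
    sqdist (rho ^ n) (INR n * theta) ^ 2.
Proof.
  intros Hn Hr.
  assert (Hr' : 0 <= rho < 1) by lra.
  assert (Hrn : 0 <= rho ^ n < 1).
  { split; [apply pow_le; lra | apply pow_lt_1_compat; [lra | lia]]. }
  assert (D1 : is_derive (fun s => sum_n_m (fun j =>
      / sqdist rho (vertex_angle n s j)) 1 n) theta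
    (sum_n_m (fun j => - 2 * rho * (sin (vertex_angle n theta j) /
     sqdist rho (vertex_angle n theta j) ^ 2)) 1 n)).
  { apply is_derive_sum_n_m; intros j _. unfold vertex_angle.
    pose proof (sqdist_pos rho (vertex_angle n theta j) Hr') as P.
    unfold vertex_angle in P. unfold sqdist in *.
    auto_derive; [unfold Rminus, Rdiv in P; simpl in *; lra |].
    as_real. unfold Rminus, Rdiv in *; field. lra. }
  assert (D2 : is_derive (fun s => INR n * (1 - (rho ^ n) ^ 2) / (1 - rho ^ 2) /
    sqdist (rho ^ n) (INR n * s)) theta
    (- 2 * (INR n ^ 2 * rho ^ n * (1 - (rho ^ n) ^ 2) / (1 - rho ^ 2) * sin (INR n * theta) /
    sqdist (rho ^ n) (INR n * theta) ^ 2))).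
  { pose proof (sqdist_pos (rho ^ n) (INR n * theta) Hrn) as P.
    unfold sqdist in *. set (q := rho ^ n) in *.
    auto_derive; [simpl in *; lra | as_real; field].
    split; [nra | lra]. }
  apply is_derive_unique in D1. apply is_derive_unique in D2.
  rewrite (Derive_ext _ (fun s => INR n * (1 - (rho ^ n) ^ 2) / (1 - rho ^ 2) /
    sqdist (rho ^ n) (INR n * s))) in D1.
  2:{ intros s. now apply sum_poisson_kernel. }
  pose proof (eq_trans (eq_sym D1) D2) as E. rewrite sum_n_m_Rmult_l in E. lra.
Qed.

(* On the rays [cos (n theta) = c] with [c = 1] or [c = -1], the sum over [j] of
   [/ sqdist rho phi_j] is [axis_sum n c rho]; primes denote derivatives in [rho]. *)
Definition axis_ratio (n : nat) (c rho : R) : R := (1 + c * rho ^ n) / (1 - c * rho ^ n).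

Definition axis_ratio' (n : nat) (c rho : R) : R :=
  2 * c * (INR n * rho ^ (n - 1)) / (1 - c * rho ^ n) ^ 2.

Definition axis_sum (n : nat) (c rho : R) : R :=
  INR n / (1 - rho ^ 2) * axis_ratio n c rho.

Definition axis_sum' (n : nat) (c rho : R) : R :=
  INR n * (2 * rho / (1 - rho ^ 2) ^ 2 * axis_ratio n c rho
           + axis_ratio' n c rho / (1 - rho ^ 2)).

Lemma one_minus_axis_pos (n : nat) (c rho : R) :
  (0 < n)%nat -> 0 <= rho < 1 -> c ^ 2 = 1 -> 0 < 1 - c * rho ^ n /\ 0 < 1 + c * rho ^ n.
Proof.
  intros Hn Hr Hc.
  assert (Hrn : 0 <= rho ^ n < 1).
  { split; [apply pow_le; lra | apply pow_lt_1_compat; [lra | lia]]. }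
  split; nra.
Qed.

Lemma is_derive_axis_sum (n : nat) (c rho : R) :
  (0 < n)%nat -> 0 <= rho < 1 -> c ^ 2 = 1 ->
  is_derive (axis_sum n c) rho (axis_sum' n c rho).
Proof.
  intros Hn Hr Hc.
  destruct (one_minus_axis_pos n c rho Hn Hr Hc) as [H _].
  unfold axis_sum, axis_sum', axis_ratio, axis_ratio'.
  assert (rho * rho < 1) by nra.
  auto_derive.
  - repeat split; lra.
  - replace (Init.Nat.pred n) with (n - 1)%nat by lia. field. split; lra.
Qed.

Lemma sum_poisson_axis (n : nat) (rho theta : R) :
  (0 < n)%nat -> 0 <= rho < 1 -> cos (INR n * theta) ^ 2 = 1 ->
  sum_n_m (fun j => / sqdist rho (vertex_angle n theta j)) 1 n
  = axis_sum n (cos (INR n * theta)) rho.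
Proof.
  intros Hn Hr Hc. rewrite sum_poisson_kernel by assumption.
  unfold axis_sum, axis_ratio, sqdist.
  destruct (one_minus_axis_pos n _ rho Hn Hr Hc) as [H _].
  set (c := cos _) in *. set (q := rho ^ n) in *.
  replace (1 - 2 * q * c + q ^ 2) with ((1 - c * q) ^ 2)
    by (replace (q ^ 2) with (c ^ 2 * q ^ 2) by (rewrite Hc; ring); ring).
  replace (1 - q ^ 2) with ((1 - c * q) * (1 + c * q))
    by (replace (q ^ 2) with (c ^ 2 * q ^ 2) by (rewrite Hc; ring); ring).
  as_real. field. split; [lra | nra].
Qed.

Lemma sum_poisson_axis_deriv (n : nat) (rho theta : R) :
  (0 < n)%nat -> 0 < rho < 1 -> cos (INR n * theta) ^ 2 = 1 ->
  sum_n_m (fun j => (2 * cos (vertex_angle n theta j) - 2 * rho) /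
    sqdist rho (vertex_angle n theta j) ^ 2) 1 n
  = axis_sum' n (cos (INR n * theta)) rho.
Proof.
  intros Hn Hr Hc.
  assert (D1 : is_derive (fun s => sum_n_m (fun j =>
      / sqdist s (vertex_angle n theta j)) 1 n) rho
    (sum_n_m (fun j => (2 * cos (vertex_angle n theta j) - 2 * rho) /
    sqdist rho (vertex_angle n theta j) ^ 2) 1 n)).
  { apply is_derive_sum_n_m; intros j _.
    pose proof (sqdist_pos rho (vertex_angle n theta j) ltac:(lra)) as P.
    unfold sqdist in *. auto_derive; [simpl in *; lra | as_real; field; lra]. }
  apply is_derive_unique in D1. rewrite <- D1.
  apply is_derive_unique.
  (* The closed form is available only for radii in [[0, 1)], hence the local form of
     extensionality. *)
  apply (is_derive_ext_loc (axis_sum n (cos (INR n * theta)))).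
  - apply (locally_interval _ _ 0 1); simpl; try lra.
    intros s H0 H1. symmetry. apply sum_poisson_axis; auto; lra.
  - apply is_derive_axis_sum; auto; lra.
Qed.

(** Here [r] is the radius of the point and [rho] that of the kernel. Since [sqdist rho x = (1 -
    rho^2) - 2 rho (cos x - rho)], the numerator [cos x - r = (cos x - rho) + (rho - r)] is a
    combination of [2 cos x - 2 rho] and [sqdist rho x], whose sums are known. *)
Lemma sum_radial_axis (n : nat) (r rho theta : R) :
  (0 < n)%nat -> 0 < rho < 1 -> cos (INR n * theta) ^ 2 = 1 ->
  sum_n_m (fun j => (cos (vertex_angle n theta j) - r) /
    sqdist rho (vertex_angle n theta j) ^ 2) 1 n
  = axis_sum' n (cos (INR n * theta)) rho / 2 + (rho - r) / (1 - rho ^ 2) *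
    (rho * axis_sum' n (cos (INR n * theta)) rho + axis_sum n (cos (INR n * theta)) rho).
Proof.
  intros Hn Hr Hc.
  rewrite <- sum_poisson_axis_deriv, <- sum_poisson_axis by (auto; lra).
  assert (H1 : 0 < 1 - rho ^ 2) by nra.
  rewrite (sum_n_m_ext _ (fun j =>
     (/ 2 + (rho - r) / (1 - rho ^ 2) * rho) *
     ((2 * cos (vertex_angle n theta j) - 2 * rho) /
      sqdist rho (vertex_angle n theta j) ^ 2) +
     (rho - r) / (1 - rho ^ 2) *
      / sqdist rho (vertex_angle n theta j))).
  - rewrite sum_n_m_Rplus, !sum_n_m_Rmult_l. as_real. field. lra.
  - intros j. as_real.
    pose proof (sqdist_pos rho (vertex_angle n theta j) ltac:(lra)) as P.
    unfold sqdist in *. field. split; lra.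
Qed.

(** * The Stieltjes primitive *)

Lemma derive_neg_decr (f f' : R -> R) (a b x y : R) :
  (forall t, a < t < b -> is_derive f t (f' t)) ->
  (forall t, a < t < b -> f' t <= 0) ->
  a < x -> x < y -> y < b -> f y <= f x.
Proof.
  intros Hd Hn Hx Hxy Hy.
  destruct (MVT_gen f x y f') as [c [Hc E]].
  - intros t Ht. rewrite Rmin_left, Rmax_right in Ht by lra. apply Hd; lra.
  - intros t Ht. rewrite Rmin_left, Rmax_right in Ht by lra.
    apply continuity_pt_filterlim, (ex_derive_continuous f).
    exists (f' t). apply Hd; lra.
  - rewrite Rmin_left, Rmax_right in Hc by lra.
    assert (f' c <= 0) by (apply Hn; lra). nra.
Qed.

Lemma at_right_interval (a b : R) (P : R -> Prop) :
  a < b -> (forall t, a < t < b -> P t) -> at_right a P.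
Proof.
  intros Hab H. assert (Hp : 0 < b - a) by lra. exists (mkposreal _ Hp).
  intros t Ht Hat. apply H. split; [exact Hat|].
  change (Rabs (t - a) < b - a) in Ht. apply Rabs_def2 in Ht. lra.
Qed.

Lemma at_left_interval (a b : R) (P : R -> Prop) :
  a < b -> (forall t, a < t < b -> P t) -> at_left b P.
Proof.
  intros Hab H. assert (Hp : 0 < b - a) by lra. exists (mkposreal _ Hp).
  intros t Ht Hat. apply H. split; [|exact Hat].
  change (Rabs (t - b) < b - a) in Ht. apply Rabs_def2 in Ht. lra.
Qed.

(** Plays the role of integrating [f'] over [(0, 1)]: only limits at the ends are required, where
    [f'] may be singular. *)
Lemma derive_nonpos_limits (f f' : R -> R) (l0 l1 : R) :
  (forall t, 0 < t < 1 -> is_derive f t (f' t)) ->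
  (forall t, 0 < t < 1 -> f' t <= 0) ->
  filterlim f (at_right 0) (locally l0) ->
  filterlim f (at_left 1) (locally l1) ->
  forall t, 0 < t < 1 -> l1 <= f t <= l0.
Proof.
  intros Hd Hn H0 H1 t Ht. split.
  - assert (H : Rbar_le l1 (f t)); [|exact H].
    apply (filterlim_le (F := at_left 1) f (fun _ => f t)).
    + apply (at_left_interval t); [lra|]. intros s Hs.
      apply (derive_neg_decr f f' 0 1); auto; lra.
    + exact H1.
    + apply filterlim_const.
  - assert (H : Rbar_le (f t) l0); [|exact H].
    apply (filterlim_le (F := at_right 0) (fun _ => f t) f).
    + apply (at_right_interval 0 t); [lra|]. intros s Hs.
      apply (derive_neg_decr f f' 0 1); auto; lra.
    + apply filterlim_const.
    + exact H0.
Qed.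

Lemma derive_neg_limits (f f' : R -> R) (l0 l1 : R) :
  (forall t, 0 < t < 1 -> is_derive f t (f' t)) ->
  (forall t, 0 < t < 1 -> f' t < 0) ->
  filterlim f (at_right 0) (locally l0) ->
  filterlim f (at_left 1) (locally l1) ->
  l1 < l0.
Proof.
  intros Hd Hn H0 H1.
  assert (Hn' : forall t, 0 < t < 1 -> f' t <= 0) by (intros; apply Rlt_le; auto).
  (* Limits lose strictness; it is recovered between two interior points. *)
  pose proof (derive_nonpos_limits f f' l0 l1 Hd Hn' H0 H1 (/ 3) ltac:(lra)).
  pose proof (derive_nonpos_limits f f' l0 l1 Hd Hn' H0 H1 (2 / 3) ltac:(lra)).
  assert (f (2 / 3) < f (/ 3)); [|lra].
  apply Ropp_lt_cancel.
  apply (incr_function (fun t => - f t) 0 1 (fun t => - f' t)); simpl; try lra.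
  - intros t Ht0 Ht1. apply @is_derive_opp. now apply Hd.
  - intros t Ht0 Ht1. specialize (Hn t ltac:(lra)). lra.
Qed.

Lemma nondecreasing_bounded_limit (f : R -> R) (M : R) :
  (forall x y, 0 < x -> x <= y -> f x <= f y) ->
  (forall x, 0 < x -> f x <= M) ->
  exists l, filterlim f (Rbar_locally p_infty) (locally l) /\ forall x, 0 < x -> f x <= l.
Proof.
  intros Hm HM.
  destruct (completeness (fun v => exists x, 0 < x /\ v = f x)) as [l [Hub Hlub]].
  - exists M. intros v [x [Hx ->]]. auto.
  - exists (f 1), 1. split; [lra | reflexivity].
  - assert (Hl : forall x, 0 < x -> f x <= l) by (intros x Hx; apply Hub; eauto).
    exists l. split; [|exact Hl].
    intros P [eps HP].
    assert (Hx : exists x, 0 < x /\ l - eps < f x).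
    { apply Classical_Prop.NNPP. intros Hc.
      assert (l <= l - eps); [|destruct eps; simpl in *; lra].
      apply Hlub. intros v [x [Hx ->]]. apply Rnot_lt_le. intros Hlt.
      apply Hc. eauto. }
    destruct Hx as [x [Hx Hlt]]. exists x. intros y Hy. apply HP.
    assert (f x <= f y) by (apply Hm; lra).
    assert (f y <= l) by (apply Hl; lra).
    change (Rabs (f y - l) < eps). apply Rabs_def1; destruct eps; simpl in *; lra.
Qed.

(** By scaling, [x^(-beta) / (x + a)^2] integrates over the half-line to a constant times
    [a^(-beta-1)], the weight occurring in the gradient. Exponent 2 is the one at which the
    differentiated Poisson sums are explicit. *)
Definition stieltjes_density (beta s : R) : R := Rpower s (- beta) / (1 + s) ^ 2.

(** Both ends of the half-line are improper; the interior base point [1] keeps each integral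
    proper. *)
Definition stieltjes_primitive (beta y : R) : R := RInt (stieltjes_density beta) 1 y.

Lemma stieltjes_density_pos (beta s : R) : 0 < s -> 0 < stieltjes_density beta s.
Proof.
  intros Hs. apply Rdiv_lt_0_compat; [apply exp_pos | apply pow_lt; lra].
Qed.

Lemma continuous_stieltjes_density (beta s : R) :
  0 < s -> continuous (stieltjes_density beta) s.
Proof.
  intros Hs. apply (ex_derive_continuous (stieltjes_density beta)).
  unfold stieltjes_density, Rpower. auto_derive. nra.
Qed.

Lemma is_derive_stieltjes_primitive (beta y : R) :
  0 < y -> is_derive (stieltjes_primitive beta) y (stieltjes_density beta y).
Proof.
  intros Hy. apply is_derive_RInt with (a := 1).
  - apply (locally_interval _ _ 0 p_infty); simpl; auto.
    intros x Hx _. apply @RInt_correct, @ex_RInt_continuous.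
    intros z [Hz _]. apply continuous_stieltjes_density.
    eapply Rlt_le_trans; [|exact Hz]. apply Rmin_glb_lt; lra.
  - now apply continuous_stieltjes_density.
Qed.

Lemma stieltjes_primitive_incr (beta x y : R) :
  0 < x -> x < y -> stieltjes_primitive beta x < stieltjes_primitive beta y.
Proof.
  intros Hx Hxy.
  apply (incr_function _ 0 p_infty (stieltjes_density beta)); simpl; auto.
  - intros t Ht _. now apply is_derive_stieltjes_primitive.
  - intros t Ht _. now apply stieltjes_density_pos.
Qed.

Lemma stieltjes_primitive_le (beta x y : R) :
  0 < x -> x <= y -> stieltjes_primitive beta x <= stieltjes_primitive beta y.
Proof.
  intros Hx [Hxy| ->]; [|apply Rle_refl].
  now apply Rlt_le, stieltjes_primitive_incr.
Qed.

Lemma stieltjes_primitive_1 (beta : R) : stieltjes_primitive beta 1 = 0.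
Proof. apply @RInt_point. Qed.

(** Beyond [1] the density is at most [s^(-2)], so the primitive is compared with [1 - 1/s]. *)
Lemma stieltjes_primitive_upper (beta y : R) :
  0 < beta -> 0 < y -> stieltjes_primitive beta y <= 1.
Proof.
  intros Hb Hy.
  destruct (Rle_lt_dec y 1) as [H1|H1].
    apply (Rle_trans _ (stieltjes_primitive beta 1)).
    + now apply stieltjes_primitive_le.
    + rewrite stieltjes_primitive_1; lra.
  - destruct (MVT_gen (fun s => stieltjes_primitive beta s + / s) 1 y
      (fun s => stieltjes_density beta s - / s ^ 2)) as [c [Hc E]].
    + intros s Hs. rewrite Rmin_left, Rmax_right in Hs by lra.
      apply @is_derive_plus; [apply is_derive_stieltjes_primitive; lra|].
      auto_derive; [lra | field; lra].
    + intros s Hs. rewrite Rmin_left, Rmax_right in Hs by lra.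
      apply continuity_pt_filterlim.
      apply (ex_derive_continuous (fun s => stieltjes_primitive beta s + / s)).
      exists (stieltjes_density beta s - / s ^ 2).
      apply @is_derive_plus; [apply is_derive_stieltjes_primitive; lra|].
      auto_derive; [lra | field; lra].
    + rewrite Rmin_left, Rmax_right in Hc by lra.
      rewrite stieltjes_primitive_1 in E.
      assert (Hd : stieltjes_density beta c <= / c ^ 2).
      { unfold stieltjes_density, Rdiv. rewrite <- (Rmult_1_l (/ c ^ 2)).
        apply Rmult_le_compat.
        - apply Rlt_le, exp_pos.
        - apply Rlt_le, Rinv_0_lt_compat, pow_lt; lra.
        - rewrite Rpower_Ropp. rewrite <- Rinv_1. apply Rinv_le_contravar; [lra|].
          rewrite <- (Rpower_O c) by lra. apply Rle_Rpower; lra.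
        - apply Rinv_le_contravar; [apply pow_lt; lra | apply pow_incr; lra]. }
      assert (0 < / y) by (apply Rinv_0_lt_compat; lra).
      rewrite Rinv_1 in E. nra.
Qed.

(** Below [1] the density is at most [s^(-beta)], which is integrable at [0] because [beta < 1]; the
    comparison function is [s^(1-beta) / (1-beta)]. *)
Lemma stieltjes_primitive_lower (beta y : R) :
  0 < beta < 1 -> 0 < y -> - / (1 - beta) <= stieltjes_primitive beta y.
Proof.
  intros Hb Hy.
  assert (Hi : 0 < / (1 - beta)) by (apply Rinv_0_lt_compat; lra).
  destruct (Rle_lt_dec 1 y) as [H1|H1].
  - apply (Rle_trans _ (stieltjes_primitive beta 1)).
    + rewrite stieltjes_primitive_1; lra.
    + apply stieltjes_primitive_le; lra.
  - assert (Hder : forall s, 0 < s ->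
      is_derive (fun s => stieltjes_primitive beta s - Rpower s (1 - beta) / (1 - beta)) s
        (stieltjes_density beta s - Rpower s (- beta))).
    { intros s Hs. apply @is_derive_minus; [apply is_derive_stieltjes_primitive; lra|].
      replace (Rpower s (- beta)) with (Rpower s (1 - beta) / s).
      - unfold Rpower. auto_derive; [lra | field; lra].
      - unfold Rminus. rewrite Rpower_plus, Rpower_1 by lra. field; lra. }
    destruct (MVT_gen (fun s => stieltjes_primitive beta s - Rpower s (1 - beta) / (1 - beta))
      y 1 (fun s => stieltjes_density beta s - Rpower s (- beta))) as [c [Hc E]].
    + intros s Hs. rewrite Rmin_left, Rmax_right in Hs by lra. apply Hder; lra.
    + intros s Hs. rewrite Rmin_left, Rmax_right in Hs by lra.
      apply continuity_pt_filterlim.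
      apply (ex_derive_continuous
        (fun s => stieltjes_primitive beta s - Rpower s (1 - beta) / (1 - beta))).
      eexists. apply Hder; lra.
    + rewrite Rmin_left, Rmax_right in Hc by lra.
      rewrite stieltjes_primitive_1 in E.
      assert (Hd : stieltjes_density beta c <= Rpower c (- beta)).
      { unfold stieltjes_density, Rdiv. rewrite <- Rmult_1_r.
        apply Rmult_le_compat_l; [apply Rlt_le, exp_pos|].
        rewrite <- Rinv_1. apply Rinv_le_contravar; [lra|]. nra. }
      assert (0 < Rpower y (1 - beta) / (1 - beta))
        by (apply Rdiv_lt_0_compat; [apply exp_pos | lra]).
      assert (E1 : Rpower 1 (1 - beta) = 1).
      { unfold Rpower. rewrite ln_1, Rmult_0_r, exp_0. reflexivity. }
      rewrite E1 in E. unfold Rdiv in *. nra.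
Qed.

(** Monotonicity and the two bounds give the limits; the inversion [s -> 1/s] moves the end [0] to
    infinity. Strictness comes from the values at [1] and [2]. *)
Lemma stieltjes_primitive_limits (beta : R) :
  0 < beta < 1 ->
  exists l0 l1, l0 < l1 /\
    filterlim (stieltjes_primitive beta) (at_right 0) (locally l0) /\
    filterlim (stieltjes_primitive beta) (Rbar_locally p_infty) (locally l1).
Proof.
  intros Hb.
  destruct (nondecreasing_bounded_limit (stieltjes_primitive beta) 1) as [l1 [Hl1 Hu1]].
  { apply stieltjes_primitive_le. }
  { intros x Hx. apply stieltjes_primitive_upper; lra. }
  destruct (nondecreasing_bounded_limit (fun s => - stieltjes_primitive beta (/ s))
    (/ (1 - beta))) as [l0 [Hl0 Hu0]].
  { intros x y Hx Hxy. apply Ropp_le_contravar, stieltjes_primitive_le.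
    - apply Rinv_0_lt_compat; lra.
    - apply Rinv_le_contravar; lra. }
  { intros x Hx. pose proof (stieltjes_primitive_lower beta (/ x) Hb
      (Rinv_0_lt_compat _ Hx)). lra. }
  exists (- l0), l1. repeat split.
  - specialize (Hu0 1 ltac:(lra)). specialize (Hu1 2 ltac:(lra)).
    rewrite Rinv_1 in Hu0.
    pose proof (stieltjes_primitive_incr beta 1 2 ltac:(lra) ltac:(lra)). lra.
  - apply (filterlim_ext_loc (fun s => - - stieltjes_primitive beta (/ / s))).
    + apply (at_right_interval 0 1); [lra|]. intros t Ht.
      rewrite Rinv_inv. ring.
    + apply (filterlim_comp _ _ _ (fun s => - stieltjes_primitive beta (/ / s)) Ropp
        _ (locally l0)); [|apply (filterlim_opp l0)].
      apply (filterlim_comp _ _ _ Rinv (fun s => - stieltjes_primitive beta (/ s))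
        _ (Rbar_locally p_infty)); [apply filterlim_Rinv_0_right | exact Hl0].
  - exact Hl1.
Qed.

(** * The change of variable and the transfer of signs from exponent 2 to exponent [beta + 1] *)

Definition stieltjes_var (r t : R) : R := (1 - t) * (1 - r ^ 2 * t) / t.

Lemma stieltjes_var_pos (r t : R) : 0 <= r < 1 -> 0 < t < 1 -> 0 < stieltjes_var r t.
Proof.
  intros Hr Ht. assert (r ^ 2 * t < 1) by nra.
  apply Rdiv_lt_0_compat; [nra | lra].
Qed.

Lemma is_derive_stieltjes_var (r t : R) : 0 < t ->
  is_derive (stieltjes_var r) t (- (1 - (r * t) ^ 2) / t ^ 2).
Proof.
  intros Ht. unfold stieltjes_var. auto_derive; [lra | field; lra].
Qed.

Lemma stieltjes_var_plus_sqdist (r t x : R) : 0 < t ->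
  stieltjes_var r t + sqdist r x = sqdist (r * t) x / t.
Proof. intros Ht. unfold stieltjes_var, sqdist. field. lra. Qed.

(** With [a = sqdist r (phi j)], each term is [w j] times a primitive of [x^(-beta) / (x + a)^2] in
    the variable [x = stieltjes_var r t]. *)
Definition stieltjes_sum (n : nat) (beta r : R) (phi w : nat -> R) (t : R) : R :=
  sum_n_m (fun j => w j * Rpower (sqdist r (phi j)) (- beta - 1) *
    stieltjes_primitive beta (stieltjes_var r t / sqdist r (phi j))) 1 n.

Lemma stieltjes_density_scale (beta x a : R) : 0 < x -> 0 < a ->
  Rpower a (- beta - 1) * (/ a * stieltjes_density beta (x / a))
  = Rpower x (- beta) / (x + a) ^ 2.
Proof.
  intros Hx Ha. unfold stieltjes_density.
  assert (E : Rpower (x / a) (- beta) = Rpower x (- beta) * (Rpower a beta)).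
  { unfold Rpower, Rdiv. rewrite <- exp_plus, ln_mult, ln_Rinv; auto.
    - f_equal; ring.
    - now apply Rinv_0_lt_compat. }
  assert (E1 : Rpower a (- beta - 1) = / (Rpower a beta * a)).
  { replace (- beta - 1) with (- (beta + 1)) by ring.
    now rewrite Rpower_Ropp, Rpower_plus, Rpower_1. }
  rewrite E, E1. pose proof (exp_pos (beta * ln a)) as P. fold (Rpower a beta) in P.
  field. repeat split; lra.
Qed.

(** The factor [1/t^2] in the derivative of [stieltjes_var] cancels against
    [(x + a)^2 = (sqdist (r t) (phi j) / t)^2], leaving the squared kernels at radius [r t]. *)
Lemma is_derive_stieltjes_sum (n : nat) (beta r : R) (phi w : nat -> R) (t : R) :
  0 <= r < 1 -> 0 < t < 1 ->
  is_derive (stieltjes_sum n beta r phi w) t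
    (- (1 - (r * t) ^ 2) * Rpower (stieltjes_var r t) (- beta) *
       sum_n_m (fun j => w j / sqdist (r * t) (phi j) ^ 2) 1 n).
Proof.
  intros Hr Ht. rewrite <- sum_n_m_Rmult_l.
  apply is_derive_sum_n_m; intros j _.
  pose proof (stieltjes_var_pos r t Hr Ht) as Hx.
  pose proof (sqdist_pos r (phi j) Hr) as Ha.
  pose proof (sqdist_pos (r * t) (phi j) ltac:(nra)) as Hd.
  replace (- (1 - (r * t) ^ 2) * Rpower (stieltjes_var r t) (- beta) *
     (w j / sqdist (r * t) (phi j) ^ 2))
    with (w j * Rpower (sqdist r (phi j)) (- beta - 1) *
      ((- (1 - (r * t) ^ 2) / t ^ 2 / sqdist r (phi j)) *
       stieltjes_density beta (stieltjes_var r t / sqdist r (phi j)))).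
  - apply is_derive_scal.
    apply (is_derive_comp (stieltjes_primitive beta)
             (fun s => stieltjes_var r s / sqdist r (phi j))).
    + apply is_derive_stieltjes_primitive. now apply Rdiv_lt_0_compat.
    + apply (is_derive_ext (fun s => / sqdist r (phi j) * stieltjes_var r s));
        [intros; as_real; unfold Rdiv; ring|].
      unfold Rdiv at 1. rewrite Rmult_comm.
      apply is_derive_scal, is_derive_stieltjes_var; lra.
  - transitivity (w j * (- (1 - (r * t) ^ 2) / t ^ 2) *
      (Rpower (sqdist r (phi j)) (- beta - 1) *
       (/ sqdist r (phi j) * stieltjes_density beta (stieltjes_var r t / sqdist r (phi j))))).
    + field. split; lra.
    + rewrite stieltjes_density_scale by assumption.
      rewrite stieltjes_var_plus_sqdist by lra. field. split; lra.
Qed.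

Lemma filterlim_sum_n_m (F : (R -> Prop) -> Prop) {FF : Filter F}
  (f : nat -> R -> R) (l : nat -> R) (m n : nat) :
  (forall k, filterlim (f k) F (locally (l k))) ->
  filterlim (fun t => sum_n_m (fun k => f k t) m n) F (locally (sum_n_m l m n)).
Proof.
  intros H. induction n as [|n IH].
  - destruct m as [|m].
    + rewrite sum_n_n.
      apply (filterlim_ext (f 0%nat)); [intros; now rewrite sum_n_n | apply H].
    + rewrite sum_n_m_zero by lia.
      apply (filterlim_ext (fun _ => zero)).
      { intros; now rewrite sum_n_m_zero by lia. }
      apply filterlim_const.
  - destruct (le_lt_dec m (S n)) as [Hm|Hm].
    + rewrite sum_n_Sm by lia.
      apply (filterlim_ext (fun y => plus (sum_n_m (fun k => f k y) m n) (f (S n) y))).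
      { intros; now rewrite sum_n_Sm by lia. }
      apply (filterlim_comp_2 _ _ plus IH (H (S n))).
      apply (filterlim_plus (V := R_NormedModule)).
    + rewrite sum_n_m_zero by lia.
      apply (filterlim_ext (fun _ => zero)).
      { intros; now rewrite sum_n_m_zero by lia. }
      apply filterlim_const.
Qed.

Lemma stieltjes_var_at_0 (r a : R) : 0 <= r < 1 -> 0 < a ->
  filterlim (fun t => stieltjes_var r t / a) (at_right 0) (Rbar_locally p_infty).
Proof.
  intros Hr Ha P [M HM].
  (* For [t < 1/2] the product [(1 - t) (1 - r^2 t)] is at least [(1 - r^2) / 2], so the function
     dominates [k / t]. *)
  set (k := (1 - r ^ 2) / 2 / a).
  assert (Hk : 0 < k) by (apply Rdiv_lt_0_compat; nra).
  assert (HM1 : 0 < Rabs M + 1) by (pose proof (Rabs_pos M); lra).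
  apply (at_right_interval 0 (Rmin (/ 2) (k / (Rabs M + 1)))).
  { apply Rmin_glb_lt; [lra | now apply Rdiv_lt_0_compat]. }
  intros t [Ht0 Ht]. apply HM.
  assert (Ht2 : t < / 2) by (eapply Rlt_le_trans; [exact Ht | apply Rmin_l]).
  assert (Htk : t < k / (Rabs M + 1)) by (eapply Rlt_le_trans; [exact Ht | apply Rmin_r]).
  assert (E1 : Rabs M + 1 < k / t).
  { apply Rlt_div_r in Htk; [|lra]. apply Rlt_div_r; lra. }
  assert (E2 : k / t <= stieltjes_var r t / a).
  { unfold k, stieltjes_var.
    replace ((1 - r ^ 2) / 2 / a / t) with ((1 - r ^ 2) / 2 * / (t * a)) by (field; lra).
    replace ((1 - t) * (1 - r ^ 2 * t) / t / a)
      with ((1 - t) * (1 - r ^ 2 * t) * / (t * a)) by (field; lra).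
    apply Rmult_le_compat_r; [apply Rlt_le, Rinv_0_lt_compat; nra|].
    assert (0 <= r ^ 2 <= 1) by nra. nra. }
  pose proof (Rle_abs M). lra.
Qed.

(** The target filter is one-sided because [stieltjes_primitive] is controlled only to the right of
    [0]. *)
Lemma stieltjes_var_at_1 (r a : R) : 0 <= r < 1 -> 0 < a ->
  filterlim (fun t => stieltjes_var r t / a) (at_left 1) (at_right 0).
Proof.
  intros Hr Ha P HP. unfold at_right, within in HP.
  assert (Hc : filterlim (fun t => stieltjes_var r t / a) (locally 1) (locally 0)).
  { replace 0 with (stieltjes_var r 1 / a) by (unfold stieltjes_var; field; lra).
    apply (ex_derive_continuous (fun t => stieltjes_var r t / a)).
    unfold stieltjes_var. auto_derive. lra. }
  specialize (Hc _ HP). unfold filtermap in Hc.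
  assert (H0 : locally 1 (fun t => 0 < t)).
  { apply (locally_interval _ _ 0 p_infty); simpl; auto. lra. }
  pose proof (filter_and _ _ Hc H0) as H. unfold filtermap, at_left, within.
  revert H. apply filter_imp. intros t [H Ht0] Ht1. apply H.
  apply Rdiv_lt_0_compat; [apply stieltjes_var_pos; lra | exact Ha].
Qed.

(* Substituting [x = stieltjes_var r t] and then [x = a y] in
   [∫_0^∞ x^(-beta) / (x + a)^2 dx] gives [a^(-beta-1) (l1 - l0)]; an added term
   [e] vanishing at both ends does not change the total variation. *)
Lemma stieltjes_sum_limits (n : nat) (beta r : R) (phi w : nat -> R) (e e' : R -> R) :
  0 < beta < 1 -> 0 <= r < 1 ->
  (forall t, 0 < t < 1 -> is_derive e t (e' t)) ->
  filterlim e (at_right 0) (locally 0) ->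
  filterlim e (at_left 1) (locally 0) ->
  exists (Y : R -> R) (l0 l1 : R), l0 < l1 /\
    (forall t, 0 < t < 1 -> is_derive Y t
      (- (1 - (r * t) ^ 2) * Rpower (stieltjes_var r t) (- beta) *
         sum_n_m (fun j => w j / sqdist (r * t) (phi j) ^ 2) 1 n + e' t)) /\
    filterlim Y (at_right 0) (locally
      (l1 * sum_n_m (fun j => w j * Rpower (sqdist r (phi j)) (- beta - 1)) 1 n)) /\
    filterlim Y (at_left 1) (locally
      (l0 * sum_n_m (fun j => w j * Rpower (sqdist r (phi j)) (- beta - 1)) 1 n)).
Proof.
  intros Hb Hr He He0 He1.
  destruct (stieltjes_primitive_limits beta Hb) as [l0 [l1 [Hl [H0 H1]]]].
  exists (fun t => stieltjes_sum n beta r phi w t + e t), l0, l1.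
  (* The two ends differ only in the filter [F] and in the limit [l] of the primitive. *)
  assert (HL : forall F, Filter F -> forall l,
    filterlim e F (locally 0) ->
    (forall j, filterlim (fun t => stieltjes_primitive beta
       (stieltjes_var r t / sqdist r (phi j))) F (locally l)) ->
    filterlim (fun t => stieltjes_sum n beta r phi w t + e t) F (locally
      (l * sum_n_m (fun j => w j * Rpower (sqdist r (phi j)) (- beta - 1)) 1 n))).
  { intros F FF l HeF HF. rewrite <- (Rplus_0_r (l * _)).
    assert (HS : filterlim (stieltjes_sum n beta r phi w) F (locally
      (l * sum_n_m (fun j => w j * Rpower (sqdist r (phi j)) (- beta - 1)) 1 n))).
    { rewrite <- sum_n_m_Rmult_l.
      apply filterlim_sum_n_m; [exact FF|]. intros j.
      rewrite (Rmult_comm l).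
      apply (filterlim_comp _ _ _
        (fun t => stieltjes_primitive beta (stieltjes_var r t / sqdist r (phi j)))
        (Rmult (w j * Rpower (sqdist r (phi j)) (- beta - 1))) _ (locally l)); [apply HF|].
      apply (filterlim_scal_r (V := R_NormedModule)). }
    apply (filterlim_comp_2 _ _ plus HS HeF).
    apply (filterlim_plus (V := R_NormedModule)). }
  split; [exact Hl | split; [|split]].
  - intros t Ht. apply @is_derive_plus; [now apply is_derive_stieltjes_sum | now apply He].
  - apply HL; [apply at_right_proper_filter | exact He0 |]. intros j.
    apply (filterlim_comp _ _ _ (fun t => stieltjes_var r t / sqdist r (phi j))
      (stieltjes_primitive beta) _ (Rbar_locally p_infty)); [|exact H1].
    apply stieltjes_var_at_0; [exact Hr | now apply sqdist_pos].
  - apply HL; [apply at_left_proper_filter | exact He1 |]. intros j.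
    apply (filterlim_comp _ _ _ (fun t => stieltjes_var r t / sqdist r (phi j))
      (stieltjes_primitive beta) _ (at_right 0)); [|exact H0].
    apply stieltjes_var_at_1; [exact Hr | now apply sqdist_pos].
Qed.

(** The function [Y] decreases from [l1] times the sum to [l0] times the sum, and [l0 < l1]. *)
Lemma stieltjes_nonneg (n : nat) (beta r : R) (phi w : nat -> R) :
  0 < beta < 1 -> 0 <= r < 1 ->
  (forall t, 0 < t < 1 -> 0 <= sum_n_m (fun j => w j / sqdist (r * t) (phi j) ^ 2) 1 n) ->
  0 <= sum_n_m (fun j => w j * Rpower (sqdist r (phi j)) (- beta - 1)) 1 n.
Proof.
  intros Hb Hr Hp.
  destruct (stieltjes_sum_limits n beta r phi w (fun _ => 0) (fun _ => 0) Hb Hr)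
    as [Y [l0 [l1 [Hl [Hd [H0 H1]]]]]].
  - intros t _. apply @is_derive_const.
  - apply filterlim_const.
  - apply filterlim_const.
  - edestruct (derive_nonpos_limits Y) as [Ha Hb'];
      [exact Hd | | exact H0 | exact H1 | |].
    + intros t Ht. specialize (Hp t Ht).
      assert (0 < Rpower (stieltjes_var r t) (- beta)) by apply exp_pos.
      assert (0 <= r * t <= 1) by nra. assert (0 <= 1 - (r * t) ^ 2) by nra.
      assert (0 <= (1 - (r * t) ^ 2) * Rpower (stieltjes_var r t) (- beta)
        * sum_n_m (fun j => w j / sqdist (r * t) (phi j) ^ 2) 1 n).
      { apply Rmult_le_pos; [apply Rmult_le_pos; lra | exact Hp]. }
      lra.
    + instantiate (1 := / 2). lra.
    + nra.
Qed.

(** The term [e] leaves the end limits unchanged, so the integrand needs a constant sign only after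
    the correction by [e']. *)
Lemma stieltjes_pos (n : nat) (beta r : R) (phi w : nat -> R) (e e' : R -> R) :
  0 < beta < 1 -> 0 <= r < 1 ->
  (forall t, 0 < t < 1 -> is_derive e t (e' t)) ->
  filterlim e (at_right 0) (locally 0) ->
  filterlim e (at_left 1) (locally 0) ->
  (forall t, 0 < t < 1 ->
    - (1 - (r * t) ^ 2) * Rpower (stieltjes_var r t) (- beta) *
      sum_n_m (fun j => w j / sqdist (r * t) (phi j) ^ 2) 1 n + e' t < 0) ->
  0 < sum_n_m (fun j => w j * Rpower (sqdist r (phi j)) (- beta - 1)) 1 n.
Proof.
  intros Hb Hr He He0 He1 Hn.
  destruct (stieltjes_sum_limits n beta r phi w e e' Hb Hr He He0 He1)
    as [Y [l0 [l1 [Hl [Hd [H0 H1]]]]]].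
  pose proof (derive_neg_limits Y _ _ _ Hd Hn H0 H1). nra.
Qed.

(** * Forces in polar coordinates *)

(** The angular derivative of the potential is [- 2 beta r] times this sum, and its radial
    derivative is [2 beta] times [radial_force]. *)
Definition tangential_force (n : nat) (beta r theta : R) : R :=
  sum_n_m (fun j => sin (vertex_angle n theta j) *
    Rpower (sqdist r (vertex_angle n theta j)) (- beta - 1)) 1 n.

Definition radial_force (n : nat) (beta r theta : R) : R :=
  sum_n_m (fun j => (cos (vertex_angle n theta j) - r) *
    Rpower (sqdist r (vertex_angle n theta j)) (- beta - 1)) 1 n.

(** The factor [s] lets one argument treat both signs of [sin (n theta)]. *)
Lemma angular_sum_sign (n : nat) (rho theta s : R) :
  (0 < n)%nat -> 0 < rho < 1 ->
  exists k, 0 < k /\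
  sum_n_m (fun j => s * sin (vertex_angle n theta j) /
    sqdist rho (vertex_angle n theta j) ^ 2) 1 n = k * (s * sin (INR n * theta)).
Proof.
  intros Hn Hr.
  assert (Hrn : 0 < rho ^ n < 1).
  { split; [apply pow_lt; lra | apply pow_lt_1_compat; [lra | lia]]. }
  pose proof (sqdist_pos (rho ^ n) (INR n * theta) ltac:(lra)) as P.
  assert (Hn0 : 0 < INR n) by (apply lt_0_INR; lia).
  assert (H1 : 0 < 1 - rho ^ 2) by nra.
  exists (INR n ^ 2 * rho ^ n * (1 - (rho ^ n) ^ 2) / (1 - rho ^ 2) /
    sqdist (rho ^ n) (INR n * theta) ^ 2 / rho). split.
  - repeat apply Rdiv_lt_0_compat; try lra; [|nra].
    apply Rmult_lt_0_compat; [|nra].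
    apply Rmult_lt_0_compat; [nra | lra].
  - rewrite (sum_n_m_ext _ (fun j => s * (sin (vertex_angle n theta j) /
      sqdist rho (vertex_angle n theta j) ^ 2))) by (intros; as_real; unfold Rdiv; ring).
    rewrite sum_n_m_Rmult_l.
    apply (Rmult_eq_reg_l rho); [|lra].
    rewrite (Rmult_comm s), <- Rmult_assoc, sum_sin_poisson_kernel by assumption.
    field. lra.
Qed.

Lemma tangential_force_scal (n : nat) (beta r theta s : R) :
  sum_n_m (fun j => s * sin (vertex_angle n theta j) *
    Rpower (sqdist r (vertex_angle n theta j)) (- beta - 1)) 1 n
  = s * tangential_force n beta r theta.
Proof.
  unfold tangential_force. rewrite <- sum_n_m_Rmult_l.
  apply sum_n_m_ext; intros; as_real; ring.
Qed.

Lemma tangential_force_sign (n : nat) (beta r theta s : R) :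
  (0 < n)%nat -> 0 < beta < 1 -> 0 < r < 1 -> 0 < s * sin (INR n * theta) ->
  0 < s * tangential_force n beta r theta.
Proof.
  intros Hn Hb Hr Hs. rewrite <- tangential_force_scal.
  apply (stieltjes_pos n beta r _ _ (fun _ => 0) (fun _ => 0)); try lra.
  - intros t _. apply @is_derive_const.
  - apply filterlim_const.
  - apply filterlim_const.
  - intros t Ht.
    destruct (angular_sum_sign n (r * t) theta s Hn ltac:(nra)) as [k [Hk E]].
    assert (0 < Rpower (stieltjes_var r t) (- beta)) by apply exp_pos.
    assert (0 < r * t < 1) by nra.
    assert (0 < 1 - (r * t) ^ 2) by nra.
    assert (0 < (1 - (r * t) ^ 2) * Rpower (stieltjes_var r t) (- beta)
      * (k * (s * sin (INR n * theta))))
      by (apply Rmult_lt_0_compat; apply Rmult_lt_0_compat; assumption).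
    rewrite E. lra.
Qed.

Lemma tangential_force_eq_0 (n : nat) (beta r theta : R) :
  (0 < n)%nat -> 0 < beta < 1 -> 0 < r < 1 ->
  tangential_force n beta r theta = 0 <-> sin (INR n * theta) = 0.
Proof.
  intros Hn Hb Hr. split; intros H0.
  - destruct (Rtotal_order (sin (INR n * theta)) 0) as [H|[H|H]]; [|exact H|].
    + pose proof (tangential_force_sign n beta r theta (-1) Hn Hb Hr ltac:(lra)). lra.
    + pose proof (tangential_force_sign n beta r theta 1 Hn Hb Hr ltac:(lra)). lra.
  (* When [sin (n theta) = 0] the integrand vanishes for each [s]; taking [s = 1] and [s = -1]
     bounds the force from both sides. *)
  - assert (H : forall s, 0 <= s * tangential_force n beta r theta).
    { intros s. rewrite <- tangential_force_scal.
      apply stieltjes_nonneg; [exact Hb | lra |]. intros t Ht.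
      destruct (angular_sum_sign n (r * t) theta s Hn ltac:(nra)) as [k [Hk ->]].
      rewrite H0. lra. }
    pose proof (H 1). pose proof (H (-1)). lra.
Qed.

(* The variation with [r] of the integrand is pointwise of constant sign only for
   fixed [t], not for fixed [x = stieltjes_var r t].  Passing from one to the other
   adds the exact derivative of this term, which is the product of the integrand
   in [x] with half the derivative of [x] in [r]. *)
Definition axis_corrector (n : nat) (beta c r t : R) : R :=
  - r * (1 - t) * t * Rpower (stieltjes_var r t) (- beta) * axis_sum n c (r * t).

Definition axis_corrector' (n : nat) (beta c r t : R) : R :=
  - r * Rpower (stieltjes_var r t) (- beta) *
  ((1 - 2 * t) * axis_sum n c (r * t) + (1 - t) * t * (r * axis_sum' n c (r * t))
   + beta * (1 - (r * t) ^ 2) / (1 - r ^ 2 * t) * axis_sum n c (r * t)).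

(** The logarithmic derivative of [x^(-beta)] is [beta (1 - (r t)^2) / (t^2 x)]. Multiplied by
    [(1 - t) t] it loses its singularities, as [(1 - t) / (t x) = 1 / (1 - r^2 t)]. *)
Lemma is_derive_axis_corrector (n : nat) (beta c r t : R) :
  (0 < n)%nat -> c ^ 2 = 1 -> 0 <= r < 1 -> 0 < t < 1 ->
  is_derive (axis_corrector n beta c r) t (axis_corrector' n beta c r t).
Proof.
  intros Hn Hc Hr Ht.
  pose proof (stieltjes_var_pos r t Hr Ht) as Hx.
  assert (D1 : is_derive (fun s => Rpower (stieltjes_var r s) (- beta)) t
    (- beta * (- (1 - (r * t) ^ 2) / t ^ 2 / stieltjes_var r t)
       * Rpower (stieltjes_var r t) (- beta))).
  { apply (is_derive_ext (fun s => exp (- beta * ln (stieltjes_var r s))));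
      [reflexivity|].
    pose proof (is_derive_stieltjes_var r t ltac:(lra)) as D.
    set (x := stieltjes_var r) in *.
    auto_derive.
    - split; [eexists; exact D | lra].
    - apply is_derive_unique in D. change (Derive (fun s : R => x s) t) with (Derive x t).
      rewrite D. unfold Rpower. field. lra. }
  assert (D2 : is_derive (fun s => axis_sum n c (r * s)) t (r * axis_sum' n c (r * t))).
  { apply (is_derive_comp (axis_sum n c) (fun s => r * s)).
    - apply is_derive_axis_sum; auto. nra.
    - auto_derive; [exact I | ring]. }
  unfold axis_corrector, axis_corrector'.
  assert (Hd : 0 < 1 - r ^ 2 * t) by nra.
  set (Q' := axis_sum' n c (r * t)) in *.
  set (P := fun s => Rpower (stieltjes_var r s) (- beta)) in *.
  set (Q := fun s => axis_sum n c (r * s)) in *.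
  change (is_derive (fun s => - r * (1 - s) * s * P s * Q s) t
    (- r * P t * ((1 - 2 * t) * Q t + (1 - t) * t * (r * Q')
     + beta * (1 - (r * t) ^ 2) / (1 - r ^ 2 * t) * Q t))).
  change (Rpower (stieltjes_var r t) (- beta)) with (P t) in D1.
  auto_derive.
  - repeat split; eexists; eassumption.
  - apply (is_derive_unique P) in D1. apply (is_derive_unique Q) in D2.
    change (Derive (fun s : R => P s) t) with (Derive P t).
    change (Derive (fun s : R => Q s) t) with (Derive Q t).
    rewrite D1, D2.
    unfold stieltjes_var. field. repeat split; lra.
Qed.

Lemma Rpower_at_0 (a : R) : 0 < a ->
  filterlim (fun t => Rpower t a) (at_right 0) (locally 0).
Proof.
  intros Ha P [eps HP].
  apply (at_right_interval 0 (Rpower eps (/ a))); [apply exp_pos|].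
  intros t Ht. apply HP. change (Rabs (Rpower t a - 0) < eps).
  rewrite Rminus_0_r, Rabs_pos_eq by apply Rlt_le, exp_pos.
  replace (pos eps) with (Rpower (Rpower eps (/ a)) a).
  - now apply Rlt_Rpower_l.
  - rewrite Rpower_mult, Rinv_l, Rpower_1; [reflexivity | apply cond_pos | lra].
Qed.

Lemma filterlim_mult_0 (F : (R -> Prop) -> Prop) {FF : Filter F} (f g : R -> R) (l : R) :
  filterlim f F (locally l) -> filterlim g F (locally 0) ->
  filterlim (fun t => f t * g t) F (locally 0).
Proof.
  intros Hf Hg. rewrite <- (Rmult_0_r l).
  apply (filterlim_comp_2 _ _ Rmult Hf Hg).
  apply (filterlim_mult (K := R_AbsRing)).
Qed.

Lemma ex_derive_filterlim_within (D : R -> Prop) (f : R -> R) (x : R) :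
  ex_derive f x -> filterlim f (within D (locally x)) (locally (f x)).
Proof.
  intros H P HP. pose proof (ex_derive_continuous f x H P HP) as HC.
  unfold filtermap, within in *. revert HC. apply filter_imp. intros t Ht _. exact Ht.
Qed.

Lemma ex_derive_axis_sum_scal (n : nat) (c r t : R) :
  (0 < n)%nat -> c ^ 2 = 1 -> 0 <= r * t < 1 ->
  ex_derive (fun s => axis_sum n c (r * s)) t.
Proof.
  intros Hn Hc Hr. apply (ex_derive_comp (axis_sum n c) (fun s => r * s)).
  - eexists. now apply is_derive_axis_sum.
  - auto_derive. exact I.
Qed.

Lemma Rpower_mult_base (x y z : R) : 0 < x -> 0 < y ->
  Rpower (x * y) z = Rpower x z * Rpower y z.
Proof. intros; now rewrite Rpower_mult_distr. Qed.

Lemma Rpower_Rinv_opp (x z : R) : 0 < x -> Rpower (/ x) (- z) = Rpower x z.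
Proof.
  intros Hx. unfold Rpower. rewrite ln_Rinv by exact Hx. f_equal; ring.
Qed.

(** Near [0] the factor [t x^(-beta)] is [t^(1+beta)] times a regular function, which goes into
    [g]. *)
Lemma axis_corrector_at_0 (n : nat) (beta c r : R) :
  (0 < n)%nat -> 0 < beta -> c ^ 2 = 1 -> 0 <= r < 1 ->
  filterlim (axis_corrector n beta c r) (at_right 0) (locally 0).
Proof.
  intros Hn Hb Hc Hr.
  set (g := fun t => - r * (1 - t) * Rpower ((1 - t) * (1 - r ^ 2 * t)) (- beta)
                     * axis_sum n c (r * t)).
  apply (filterlim_ext_loc (fun t => g t * Rpower t (1 + beta))).
  - apply (at_right_interval 0 1); [lra|]. intros t Ht.
    assert (0 < 1 - r ^ 2 * t) by nra.
    unfold g, axis_corrector, stieltjes_var, Rdiv.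
    rewrite (Rpower_mult_base (_ * _)), Rpower_Rinv_opp, Rpower_plus, Rpower_1;
      first [lra | as_real; ring | apply Rinv_0_lt_compat; lra | nra].
  - apply (filterlim_mult_0 _ g _ (g 0)); [|apply Rpower_at_0; lra].
    apply ex_derive_filterlim_within. unfold g, Rpower.
    pose proof (ex_derive_axis_sum_scal n c r 0 Hn Hc ltac:(lra)) as D.
    set (Q := fun s => axis_sum n c (r * s)) in D.
    change (ex_derive (fun t => - r * (1 - t) *
      exp (- beta * ln ((1 - t) * (1 - r ^ 2 * t))) * Q t) 0).
    auto_derive. split; [lra | split; [exact D | exact I]].
Qed.

(** Near [1] the factor [(1 - t) x^(-beta)] is [(1 - t)^(1-beta)] times a regular function, and
    [beta < 1] makes it vanish. *)
Lemma axis_corrector_at_1 (n : nat) (beta c r : R) :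
  (0 < n)%nat -> beta < 1 -> c ^ 2 = 1 -> 0 <= r < 1 ->
  filterlim (axis_corrector n beta c r) (at_left 1) (locally 0).
Proof.
  intros Hn Hb Hc Hr.
  set (g := fun t => - r * t * Rpower ((1 - r ^ 2 * t) * / t) (- beta)
                     * axis_sum n c (r * t)).
  apply (filterlim_ext_loc (fun t => g t * Rpower (1 - t) (1 - beta))).
  - apply (at_left_interval 0); [lra|]. intros t Ht.
    assert (0 < 1 - r ^ 2 * t) by nra.
    assert (0 < / t) by (apply Rinv_0_lt_compat; lra).
    unfold g, axis_corrector, stieltjes_var, Rdiv.
    replace (1 - beta) with (1 + - beta) by ring.
    replace ((1 - t) * (1 - r ^ 2 * t) * / t)
      with ((1 - t) * ((1 - r ^ 2 * t) * / t)) by ring.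
    rewrite (Rpower_mult_base (1 - t)), Rpower_plus, Rpower_1; first [lra | as_real; ring | nra].
  - apply (filterlim_mult_0 _ g _ (g 1)).
    + apply ex_derive_filterlim_within. unfold g, Rpower.
      pose proof (ex_derive_axis_sum_scal n c r 1 Hn Hc ltac:(lra)) as D.
      set (Q := fun s => axis_sum n c (r * s)) in D.
      change (ex_derive (fun t => - r * t *
        exp (- beta * ln ((1 - r ^ 2 * t) * / t)) * Q t) 1).
      auto_derive. assert (0 < 1 - r ^ 2) by nra. simpl in *.
      rewrite Rinv_1. repeat split; try lra. exact D.
    + apply (filterlim_comp _ _ _ (fun t => 1 - t) (fun s => Rpower s (1 - beta))
        _ (at_right 0)); [|apply Rpower_at_0; lra].
      intros P [eps HP]. exists eps. intros t Ht Ht1. apply HP; [|lra].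
      change (Rabs (1 - t - 0) < eps). change (Rabs (t - 1) < eps) in Ht.
      rewrite <- Rabs_Ropp. now replace (- (1 - t - 0)) with (t - 1) by ring.
Qed.

(* Up to a positive factor, the derivative in [r], for fixed [t], of the integrand
   [x^(-beta) * axis_ratio n c (r t) / t] with [x = stieltjes_var r t]. *)
Lemma axis_ratio_growth (n : nat) (beta c r t : R) :
  (2 <= n)%nat -> 0 < beta -> 0 < r < 1 -> 0 < t < 1 ->
  c = 1 \/ c = -1 /\ INR n * r ^ (n - 2) <= beta ->
  0 < 2 * beta * r / (1 - r ^ 2 * t) * axis_ratio n c (r * t) + axis_ratio' n c (r * t).
Proof.
  intros Hn Hb Hr Ht Hc.
  assert (Hrt : 0 < r * t < 1) by nra.
  assert (Hd : 0 < 1 - r ^ 2 * t) by nra.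
  assert (Hy : 0 < (r * t) ^ n < 1).
  { split; [apply pow_lt; lra | apply pow_lt_1_compat; [lra | lia]]. }
  assert (Hy1 : 0 < (r * t) ^ (n - 1)) by (apply pow_lt; lra).
  assert (Hn0 : 0 < INR n) by (apply lt_0_INR; lia).
  unfold axis_ratio, axis_ratio'. set (y := (r * t) ^ n) in *.
  destruct Hc as [-> | [-> Hs]].
  - apply Rplus_lt_0_compat.
    + apply Rmult_lt_0_compat; apply Rdiv_lt_0_compat; nra.
    + apply Rdiv_lt_0_compat; nra.
  - replace (2 * beta * r / (1 - r ^ 2 * t) * ((1 + -1 * y) / (1 - -1 * y)) +
      2 * -1 * (INR n * (r * t) ^ (n - 1)) / (1 - -1 * y) ^ 2)
    with (2 * (beta * r * (1 - y ^ 2) - INR n * (r * t) ^ (n - 1) * (1 - r ^ 2 * t))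
      / ((1 - r ^ 2 * t) * (1 + y) ^ 2)) by (field; lra).
    (* The numerator is positive when [n (r t)^(n-1) (1 - r^2 t) < beta r (1 - y^2)]. The hypothesis
       bounds the left side by [beta r t^(n-1) (1 - r^2 t)], and [t^(n-1) - r^2 t^n < 1 - r^2 t^n <=
       1 - y^2]. *)
    apply Rdiv_lt_0_compat; [|apply Rmult_lt_0_compat; nra].
    assert (E : INR n * (r * t) ^ (n - 1) = INR n * r ^ (n - 2) * r * t ^ (n - 1)).
    { rewrite Rpow_mult_distr. replace (n - 1)%nat with (S (n - 2)) by lia. simpl. ring. }
    assert (Ht1 : 0 < t ^ (n - 1) < 1).
    { split; [apply pow_lt; lra | apply pow_lt_1_compat; [lra | lia]]. }
    assert (E1 : INR n * (r * t) ^ (n - 1) <= beta * (r * t ^ (n - 1))).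
    { rewrite E, !Rmult_assoc, <- (Rmult_assoc (INR n)).
      apply Rmult_le_compat_r; [nra | exact Hs]. }
    assert (Hyn : y ^ 2 <= r ^ 2 * t ^ n).
    { unfold y. rewrite Rpow_mult_distr, Rpow_mult_distr.
      assert (0 < r ^ n <= r).
      { split; [apply pow_lt; lra|]. replace n with (S (n - 1)) by lia. simpl.
        assert (0 < r ^ (n - 1) <= 1); [|nra].
        split; [apply pow_lt; lra|]. rewrite <- (pow1 (n - 1)). apply pow_incr; lra. }
      assert (0 < t ^ n < 1).
      { split; [apply pow_lt; lra | apply pow_lt_1_compat; [lra | lia]]. }
      assert ((r ^ n) ^ 2 <= r ^ 2) by nra.
      assert ((t ^ n) ^ 2 <= t ^ n) by nra.
      apply Rmult_le_compat; try lra; apply pow2_ge_0. }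
    assert (Etn : t ^ n = t * t ^ (n - 1)).
    { replace n with (S (n - 1)) at 1 by lia. reflexivity. }
    assert (E2 : t ^ (n - 1) * (1 - r ^ 2 * t) < 1 - y ^ 2) by nra.
    assert (Hbr : 0 < beta * r) by nra.
    assert (E3 : INR n * (r * t) ^ (n - 1) * (1 - r ^ 2 * t)
      <= beta * (r * t ^ (n - 1)) * (1 - r ^ 2 * t)) by (apply Rmult_le_compat_r; lra).
    nra.
Qed.

Lemma radial_force_axis_pos (n : nat) (beta r theta : R) :
  (2 <= n)%nat -> 0 < beta < 1 -> 0 < r < 1 ->
  cos (INR n * theta) = 1 \/
  cos (INR n * theta) = -1 /\ INR n * r ^ (n - 2) <= beta ->
  0 < radial_force n beta r theta.
Proof.
  intros Hn Hb Hr Hc.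
  set (c := cos (INR n * theta)) in *.
  assert (Hc2 : c ^ 2 = 1) by (destruct Hc as [-> | [-> _]]; ring).
  apply (stieltjes_pos n beta r _ _ (axis_corrector n beta c r)
    (axis_corrector' n beta c r)); try lra.
  - intros t Ht. apply is_derive_axis_corrector; auto; [lia | lra].
  - apply axis_corrector_at_0; auto; [lia | lra | lra].
  - apply axis_corrector_at_1; auto; [lia | lra | lra].
  - intros t Ht.
    pose proof (axis_ratio_growth n beta c r t Hn ltac:(lra) Hr Ht Hc) as G.
    assert (Hrt : 0 < r * t < 1) by nra.
    rewrite sum_radial_axis by (auto; lia). fold c.
    pose proof (exp_pos (- beta * ln (stieltjes_var r t))) as HP.
    fold (Rpower (stieltjes_var r t) (- beta)) in HP.
    assert (Hn0 : 0 < INR n) by (apply lt_0_INR; lia).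
    assert (Hd : 0 < 1 - r ^ 2 * t) by nra.
    assert (Hd' : 0 < 1 - (r * t) ^ 2) by nra.
    unfold axis_corrector', axis_sum', axis_sum.
    set (p := Rpower _ _) in *. set (L := axis_ratio _ _ _) in *.
    set (L' := axis_ratio' _ _ _) in *.
    (* The corrector cancels every term in [L] without a factor [beta]; what remains is minus a
       positive multiple of the expression in [axis_ratio_growth]. *)
    match goal with |- ?X < 0 => replace X with
      (- (p * (INR n / 2) * (2 * beta * r / (1 - r ^ 2 * t) * L + L')))
      by (field; lra) end.
    apply Ropp_lt_cancel. rewrite Ropp_involutive, Ropp_0.
    repeat apply Rmult_lt_0_compat; try lra; exact G.
Qed.

(** * Critical points *)

Lemma sum_polar_vertex (n : nat) (theta : R) : (2 <= n)%nat ->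
  sum_n_m (fun j => polar 1 (vertex_angle n theta j)) 1 n = RtoC 0.
Proof.
  intros Hn. rewrite <- (sum_vertex_powers n 1 theta 1) by lia.
  apply sum_n_m_ext. intros j. symmetry. apply Cpow_1_r.
Qed.

Lemma sum_cos_vertex (n : nat) (theta : R) : (2 <= n)%nat ->
  sum_n_m (fun j => cos (vertex_angle n theta j)) 1 n = 0.
Proof.
  intros Hn. pose proof (f_equal Re (sum_polar_vertex n theta Hn)) as E.
  rewrite Re_sum_n_m in E. change (Re (RtoC 0)) with 0 in E. rewrite <- E.
  apply sum_n_m_ext. intros j. symmetry. apply Rmult_1_l.
Qed.

Lemma sum_sin_vertex (n : nat) (theta : R) : (2 <= n)%nat ->
  sum_n_m (fun j => sin (vertex_angle n theta j)) 1 n = 0.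
Proof.
  intros Hn. pose proof (sum_cos_vertex n (theta - PI / 2) Hn) as E.
  rewrite <- E. apply sum_n_m_ext. intros j.
  replace (vertex_angle n (theta - PI / 2) j) with (vertex_angle n theta j - PI / 2)
    by (unfold vertex_angle; ring).
  rewrite cos_minus, cos_PI2, sin_PI2. as_real. ring.
Qed.

(* [cos (n x)] is a polynomial in [cos x]. *)
Lemma cos_mult_eq (x y : R) (n : nat) :
  cos x = cos y -> cos (INR n * x) = cos (INR n * y).
Proof.
  intros E.
  assert (Rec : forall z m, cos (INR (S (S m)) * z)
    = 2 * cos z * cos (INR (S m) * z) - cos (INR m * z)).
  { intros z m. rewrite !S_INR.
    replace ((INR m + 1 + 1) * z) with ((INR m + 1) * z + z) by ring.
    replace (INR m * z) with ((INR m + 1) * z - z) by ring.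
    rewrite cos_plus, cos_minus. ring. }
  assert (H : cos (INR n * x) = cos (INR n * y) /\
              cos (INR (S n) * x) = cos (INR (S n) * y)); [|apply H].
  induction n as [|n [IH0 IH1]].
  - simpl. rewrite !Rmult_0_l, !Rmult_1_l. now split.
  - split; [exact IH1|]. now rewrite !Rec, E, IH0, IH1.
Qed.

(** Replace [x] by [a = acos (cos x)] in [[0, PI]], which keeps [cos (n x)]. If [a < PI / n], then
    [n a < PI] and [cos (n a) > -1]. *)
Lemma cos_le_r_u (n : nat) (x : R) : (1 <= n)%nat ->
  cos (INR n * x) = -1 -> cos x <= r_u n.
Proof.
  intros Hn Hc. apply Rnot_lt_le. intros Hlt. unfold r_u in Hlt.
  assert (Hn0 : 1 <= INR n) by (apply (le_INR 1); exact Hn).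
  pose proof PI_RGT_0 as HPI.
  pose proof (COS_bound x) as Hb. pose proof (acos_bound (cos x)) as Ha.
  assert (Ec : cos (acos (cos x)) = cos x) by (apply cos_acos; exact Hb).
  rewrite (cos_mult_eq x (acos (cos x))) in Hc by auto.
  rewrite <- Ec in Hlt. set (a := acos (cos x)) in *.
  assert (Hp : 0 <= PI / INR n <= PI).
  { split; [apply Rlt_le, Rdiv_lt_0_compat; lra|]. apply Rle_div_l; nra. }
  assert (Hal : a < PI / INR n) by (apply cos_decreasing_0; lra).
  apply Rlt_div_r in Hal; [|lra].
  assert (cos PI < cos (INR n * a)); [|rewrite cos_PI in *; lra].
  apply cos_decreasing_1; nra.
Qed.

(** All numerators [cos phi_j - r] are nonpositive, so each weight may be lowered to the common
    bound [m], squared distances being below [4]. The cosines then sum to zero and [- n m r]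
    remains, which is strictly negative. *)
Lemma radial_force_neg (n : nat) (beta r theta : R) :
  (2 <= n)%nat -> 0 < beta -> 0 < r < 1 -> r_u n <= r ->
  cos (INR n * theta) = -1 -> radial_force n beta r theta < 0.
Proof.
  intros Hn Hb Hr Hu Hc.
  assert (Hn0 : 0 < INR n) by (apply lt_0_INR; lia).
  set (m := Rpower 4 (- beta - 1)).
  assert (Hm : 0 < m) by apply exp_pos.
  apply (Rle_lt_trans _ (sum_n_m (fun j => m * cos (vertex_angle n theta j) + m * - r) 1 n)).
  - apply sum_n_m_le. intros j.
    assert (Hcj : cos (vertex_angle n theta j) <= r).
    { apply (Rle_trans _ (r_u n)); [|exact Hu]. apply cos_le_r_u; [lia|].
      now rewrite mult_vertex_angle, cos_sub_period by lia. }
    assert (HP : m <= Rpower (sqdist r (vertex_angle n theta j)) (- beta - 1)).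
    { pose proof (sqdist_pos r (vertex_angle n theta j) ltac:(lra)) as P.
      unfold m. replace (- beta - 1) with (- (beta + 1)) by ring.
      rewrite !Rpower_Ropp. apply Rinv_le_contravar; [apply exp_pos|].
      apply Rle_Rpower_l; [lra|]. split; [exact P|].
      unfold sqdist. pose proof (COS_bound (vertex_angle n theta j)). nra. }
    nra.
  - rewrite sum_n_m_Rplus, sum_n_m_Rmult_l, sum_n_m_const, sum_cos_vertex by exact Hn.
    replace (S n - 1)%nat with n by lia.
    change (m * 0 + INR n * (m * - r) < 0).
    assert (0 < INR n * (m * r)) by (repeat apply Rmult_lt_0_compat; lra). lra.
Qed.

(** * The gradient of the potential in terms of the polar forces *)

Lemma Cmod_polar (r theta : R) : 0 <= r -> Cmod (polar r theta) = r.
Proof.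
  intros Hr. unfold Cmod, polar; simpl.
  replace (r * cos theta * (r * cos theta * 1) + r * sin theta * (r * sin theta * 1))
    with (r * r).
  - now apply sqrt_square.
  - pose proof (sin2_cos2 theta) as E; unfold Rsqr in E. nra.
Qed.

(** Differentiating a power of the modulus, a square root, produces the left side; the forces use
    the right side. *)
Lemma Rpower_sqrt_opp (s beta : R) : 0 < s ->
  Rpower (sqrt s) (- 2 * beta) / s = Rpower s (- beta - 1).
Proof.
  intros Hs. unfold Rminus. rewrite Rpower_plus, <- Rpower_sqrt, Rpower_mult by exact Hs.
  rewrite (Rpower_Ropp s 1), Rpower_1 by exact Hs.
  unfold Rdiv. f_equal. f_equal. field.
Qed.

Lemma is_derive_riesz_x (beta x y a b : R) : 0 < (x - a) ^ 2 + (y - b) ^ 2 ->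
  is_derive (fun u => Rpower (Cmod ((u, y) - (a, b))%C) (- 2 * beta)) x
    (- 2 * beta * (x - a) * Rpower ((x - a) ^ 2 + (y - b) ^ 2) (- beta - 1)).
Proof.
  intros Hs. rewrite <- Rpower_sqrt_opp by exact Hs.
  pose proof (sqrt_lt_R0 _ Hs) as Hq.
  assert (Hss : sqrt ((x - a) ^ 2 + (y - b) ^ 2) * sqrt ((x - a) ^ 2 + (y - b) ^ 2)
    = (x - a) ^ 2 + (y - b) ^ 2) by (apply sqrt_sqrt; lra).
  unfold Cmod; simpl.
  apply (is_derive_ext (fun u => exp (- 2 * beta * ln (sqrt ((u - a) ^ 2 + (y - b) ^ 2))))).
  { intros u. unfold Rpower. simpl. unfold Rminus. reflexivity. }
  auto_derive.
  - simpl in *. unfold Rminus in *. repeat split; assumption.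
  - unfold Rpower. simpl in *. unfold Rminus in *.
    set (s := _ + _) in Hs at 1.
    set (q := sqrt _) in *.
    replace ((x + - a) * ((x + - a) * 1) + (y + - b) * ((y + - b) * 1)) with (q * q).
    field. lra.
Qed.

Lemma is_derive_riesz_y (beta x y a b : R) : 0 < (x - a) ^ 2 + (y - b) ^ 2 ->
  is_derive (fun u => Rpower (Cmod ((x, u) - (a, b))%C) (- 2 * beta)) y
    (- 2 * beta * (y - b) * Rpower ((x - a) ^ 2 + (y - b) ^ 2) (- beta - 1)).
Proof.
  intros Hs. rewrite Rplus_comm in Hs |- *.
  (* Exchanging the coordinates preserves the modulus and reduces to the derivative in [x]. *)
  apply (is_derive_ext (fun u => Rpower (Cmod ((u, x) - (b, a))%C) (- 2 * beta))).
  - intros u. f_equal. unfold Cmod; simpl. f_equal. ring.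
  - now apply is_derive_riesz_x.
Qed.

Lemma is_gradient_riesz_polar (n : nat) (beta r theta : R) : 0 <= r < 1 ->
  is_gradient (riesz_potential n beta) (polar r theta)
    (2 * beta * (cos theta * radial_force n beta r theta
                 + sin theta * tangential_force n beta r theta),
     2 * beta * (sin theta * radial_force n beta r theta
                 + - cos theta * tangential_force n beta r theta)).
Proof.
  intros Hr.
  assert (Hs : forall j, (r * cos theta - 1 * cos (2 * PI * INR j / INR n)) ^ 2
     + (r * sin theta - 1 * sin (2 * PI * INR j / INR n)) ^ 2
     = sqdist r (vertex_angle n theta j)).
  { intros j. unfold sqdist, vertex_angle. rewrite cos_minus.
    set (a := 2 * PI * INR j / INR n).
    pose proof (sin2_cos2 theta) as E; unfold Rsqr in E.
    pose proof (sin2_cos2 a) as E1; unfold Rsqr in E1.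
    transitivity (r * r * (sin theta * sin theta + cos theta * cos theta)
      + (sin a * sin a + cos a * cos a)
      - 2 * r * (cos theta * cos a + sin theta * sin a)); [ring|].
    rewrite E, E1. ring. }
  assert (Hp : forall j, 0 < sqdist r (vertex_angle n theta j))
    by (intros; now apply sqdist_pos).
  unfold radial_force, tangential_force.
  rewrite <- !sum_n_m_Rmult_l, <- !sum_n_m_Rplus, <- !sum_n_m_Rmult_l.
  split; cbn [Re Im fst snd polar]; apply is_derive_sum_n_m; intros j _.
  - pose proof (is_derive_riesz_x beta (r * cos theta) (r * sin theta)
      (1 * cos (2 * PI * INR j / INR n)) (1 * sin (2 * PI * INR j / INR n))) as D.
    rewrite Hs in D. specialize (D (Hp j)).
    match type of D with is_derive _ _ ?a => match goal with |- is_derive _ _ ?b =>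
      replace b with a; [exact D|] end end.
    as_real.
    (* The direction of the vertex is expressed in the frame rotated by [theta], where the addition
       formula separates the radial and tangential parts. *)
    replace (2 * PI * INR j / INR n) with (theta - vertex_angle n theta j)
      by (unfold vertex_angle; ring).
    rewrite cos_minus. ring.
  - pose proof (is_derive_riesz_y beta (r * cos theta) (r * sin theta)
      (1 * cos (2 * PI * INR j / INR n)) (1 * sin (2 * PI * INR j / INR n))) as D.
    rewrite Hs in D. specialize (D (Hp j)).
    match type of D with is_derive _ _ ?a => match goal with |- is_derive _ _ ?b =>
      replace b with a; [exact D|] end end.
    as_real.
    replace (2 * PI * INR j / INR n) with (theta - vertex_angle n theta j)
      by (unfold vertex_angle; ring).
    rewrite sin_minus. ring.
Qed.

(** The gradient is [2 beta] times an orthogonal matrix applied to the two forces, so it vanishes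
    exactly when both do, including at [r = 0]. *)
Lemma critical_point_polar (n : nat) (beta r theta : R) : 0 < beta -> 0 <= r ->
  critical_point (riesz_potential n beta) (polar r theta) <->
  r < 1 /\ radial_force n beta r theta = 0 /\ tangential_force n beta r theta = 0.
Proof.
  intros Hb Hr. unfold critical_point. rewrite Cmod_polar by exact Hr.
  split.
  - intros [Hr1 [Gx Gy]]. split; [exact Hr1|].
    destruct (is_gradient_riesz_polar n beta r theta (conj Hr Hr1)) as [Dx Dy].
    apply is_derive_unique in Gx, Gy, Dx, Dy.
    rewrite Gx in Dx. rewrite Gy in Dy. simpl in Dx, Dy.
    pose proof (sin2_cos2 theta) as E; unfold Rsqr in E.
    set (A := radial_force n beta r theta) in *.
    set (B := tangential_force n beta r theta) in *.
    assert (Hx : cos theta * A + sin theta * B = 0).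
    { apply (Rmult_eq_reg_l (2 * beta)); lra. }
    assert (Hy : sin theta * A - cos theta * B = 0).
    { apply (Rmult_eq_reg_l (2 * beta)); lra. }
    split.
    + transitivity ((sin theta * sin theta + cos theta * cos theta) * A); [rewrite E; ring|].
      transitivity (cos theta * (cos theta * A + sin theta * B)
        + sin theta * (sin theta * A - cos theta * B)); [ring|].
      rewrite Hx, Hy. ring.
    + transitivity ((sin theta * sin theta + cos theta * cos theta) * B); [rewrite E; ring|].
      transitivity (sin theta * (cos theta * A + sin theta * B)
        - cos theta * (sin theta * A - cos theta * B)); [ring|].
      rewrite Hx, Hy. ring.
  - intros [Hr1 [HA HB]]. split; [exact Hr1|].
    pose proof (is_gradient_riesz_polar n beta r theta (conj Hr Hr1)) as G.
    rewrite HA, HB in G.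
    match type of G with is_gradient _ _ ?a => replace a with (RtoC 0) in G; [exact G|] end.
    unfold RtoC. f_equal; ring.
Qed.

(** All vertices are at distance [1], so the forces reduce to the vanishing sums of cosines and
    sines. *)
Lemma critical_point_origin (n : nat) (beta : R) : (2 <= n)%nat -> 0 < beta ->
  critical_point (riesz_potential n beta) (RtoC 0).
Proof.
  intros Hn Hb.
  replace (RtoC 0) with (polar 0 0) by (unfold polar, RtoC; f_equal; ring).
  assert (E : forall x, Rpower (sqdist 0 x) (- beta - 1) = 1).
  { intros x. unfold sqdist, Rpower.
    replace (1 - 2 * 0 * cos x + 0 ^ 2) with 1 by ring.
    now rewrite ln_1, Rmult_0_r, exp_0. }
  apply critical_point_polar; [exact Hb | lra |]. split; [lra | split].
  - transitivity (sum_n_m (fun j => cos (vertex_angle n 0 j)) 1 n);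
      [|now apply sum_cos_vertex]. apply sum_n_m_ext. intros j.
    rewrite E. as_real. ring.
  - transitivity (sum_n_m (fun j => sin (vertex_angle n 0 j)) 1 n);
      [|now apply sum_sin_vertex]. apply sum_n_m_ext. intros j.
    rewrite E. as_real. ring.
Qed.

Lemma continuous_radial_force (n : nat) (beta r theta : R) : 0 <= r < 1 ->
  continuity_pt (fun s => radial_force n beta s theta) r.
Proof.
  intros Hr. apply continuity_pt_filterlim.
  apply (ex_derive_continuous (fun s => radial_force n beta s theta)).
  eexists. apply is_derive_sum_n_m. intros j _. apply Derive_correct.
  pose proof (sqdist_pos r (vertex_angle n theta j) Hr) as P.
  unfold Rpower, sqdist in *. auto_derive. simpl in *. lra.
Qed.

Lemma bisector_critical_point (n : nat) (beta theta : R) :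
  (3 <= n)%nat -> 0 < beta < 1 ->
  cos (INR n * theta) = -1 -> sin (INR n * theta) = 0 ->
  exists r, 0 < r /\ critical_point (riesz_potential n beta) (polar r theta).
Proof.
  intros Hn Hb Hc Hs.
  assert (Hn0 : 3 <= INR n) by (apply (le_INR 3) in Hn; simpl in Hn; lra).
  pose proof PI_RGT_0 as HPI.
  assert (Hu : 0 < r_u n < 1).
  { assert (0 < PI / INR n) by (apply Rdiv_lt_0_compat; lra).
    assert (PI / INR n < PI / 2) by (apply Rlt_div_l; nra).
    split; [apply cos_gt_0; lra | apply cos_lt_1; lra]. }
  (* At this radius [n r0^(n-2) <= n r0 = beta], because [n >= 3] and [r0 < 1]; the radial force is
     therefore positive there. *)
  set (r0 := beta / INR n).
  assert (Hr0 : 0 < r0 < 1).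
  { split; [apply Rdiv_lt_0_compat; lra | apply Rlt_div_l; lra]. }
  assert (Hp0 : 0 < radial_force n beta r0 theta).
  { apply radial_force_axis_pos; [lia | exact Hb | exact Hr0 |]. right. split; [exact Hc|].
    replace beta with (INR n * r0) by (unfold r0; field; lra).
    apply Rmult_le_compat_l; [lra|].
    replace (n - 2)%nat with (S (n - 3)) by lia. simpl.
    assert (0 < r0 ^ (n - 3) <= 1); [|nra].
    split; [apply pow_lt; lra|]. rewrite <- (pow1 (n - 3)). apply pow_incr; lra. }
  (* Otherwise the radial force at [r0] would be both positive and negative. *)
  assert (H0u : r0 < r_u n).
  { apply Rnot_le_lt. intros H.
    pose proof (radial_force_neg n beta r0 theta ltac:(lia) ltac:(lra) Hr0 H Hc). lra. }
  (* The sign is reversed because this form of the intermediate value theorem goes from a negative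
     to a positive value. *)
  destruct (Ranalysis5.IVT_interv (fun s => - radial_force n beta s theta) r0 (r_u n))
    as [r [Hr E]]; [|exact H0u | lra | |].
  - intros s Hs'. apply (continuity_pt_opp (fun s => radial_force n beta s theta)).
    apply continuous_radial_force. lra.
  - pose proof (radial_force_neg n beta (r_u n) theta ltac:(lia) ltac:(lra) Hu
      (Rle_refl _) Hc). lra.
  - exists r. split; [lra|]. apply critical_point_polar; [lra | lra |].
    split; [lra | split; [lra|]].
    apply tangential_force_eq_0; [lia | exact Hb | lra | exact Hs].
Qed.

(** Raising to the power [n - 2] gives [r^(n-2) <= beta / (beta + n)], and [n / (beta + n) <= 1]. *)
Lemma le_r_l (n : nat) (beta r : R) : (3 <= n)%nat -> 0 < beta -> 0 < r ->
  r <= r_l n beta -> INR n * r ^ (n - 2) <= beta.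
Proof.
  intros Hn Hb Hr Hl.
  assert (Hn0 : 3 <= INR n) by (apply (le_INR 3) in Hn; simpl in Hn; lra).
  assert (Hq : 0 < beta / (beta + INR n)) by (apply Rdiv_lt_0_compat; lra).
  assert (H : r ^ (n - 2) <= beta / (beta + INR n)).
  { apply (Rle_trans _ (r_l n beta ^ (n - 2))); [apply pow_incr; lra|].
    unfold r_l. rewrite <- Rpower_pow, Rpower_mult, minus_INR by (apply exp_pos || lia).
    change (INR 2) with (1 + 1).
    replace (1 / (INR n - 2) * (INR n - (1 + 1))) with 1 by (field; lra).
    rewrite Rpower_1 by exact Hq. apply Rle_refl. }
  apply (Rle_trans _ (INR n * (beta / (beta + INR n)))).
  - apply Rmult_le_compat_l; lra.
  - unfold Rdiv. rewrite <- Rmult_assoc. apply Rle_div_l; nra.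
Qed.

Theorem theorem3p1 (n : nat) (beta : R)
  (hn : (3 <= n)%nat) (hbeta : 0 < beta < 1) :
  (forall k : nat, (1 <= k <= 2 * n - 1)%nat -> Nat.Odd k ->
     exists z : C,
       on_ray (PI * INR k / INR n) z /\
       nontrivial_critical_point (riesz_potential n beta) z) /\
  critical_point (riesz_potential n beta) (RtoC 0) /\
  (forall r theta : R, 0 <= r -> 0 <= theta < 2 * PI ->
     nontrivial_critical_point (riesz_potential n beta) (polar r theta) ->
     r_l n beta < r < r_u n).
Proof.
  assert (Hn0 : 3 <= INR n) by (apply (le_INR 3) in hn; simpl in hn; lra).
  split; [|split].
  - intros k _ [m Hm].
    (* For odd [k] the angle [n theta] is an odd multiple of [PI], so its cosine is [-1]. *)
    assert (E : INR n * (PI * INR k / INR n) = PI + 2 * INR m * PI).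
    { rewrite Hm, plus_INR, mult_INR. simpl. field. lra. }
    destruct (bisector_critical_point n beta (PI * INR k / INR n) hn hbeta)
      as [r [Hr Hz]].
    + now rewrite E, cos_period, cos_PI.
    + now rewrite E, sin_period, sin_PI.
    + exists (polar r (PI * INR k / INR n)). split.
      * exists r. split; [lra | reflexivity].
      * split; [exact Hz|]. intros H0. apply (f_equal Cmod) in H0.
        rewrite Cmod_polar, Cmod_0 in H0; lra.
  - apply critical_point_origin; [lia | lra].
  - intros r theta Hr _ [Hz Hnz].
    apply critical_point_polar in Hz; [|lra | exact Hr].
    destruct Hz as [Hr1 [HR HT]].
    assert (Hr0 : 0 < r).
    { destruct Hr as [Hr| <-]; [exact Hr|]. exfalso. apply Hnz.
      unfold polar, RtoC. f_equal; ring. }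
    apply tangential_force_eq_0 in HT; [|lia | exact hbeta | lra].
    assert (Hc : cos (INR n * theta) = 1 \/ cos (INR n * theta) = -1).
    { pose proof (sin2_cos2 (INR n * theta)) as E. unfold Rsqr in E. rewrite HT in E.
      assert (E1 : (cos (INR n * theta) - 1) * (cos (INR n * theta) + 1) = 0) by lra.
      apply Rmult_integral in E1. destruct E1; [left | right]; lra. }
    destruct Hc as [Hc|Hc].
    (* The rays through the vertices are excluded: the radial force is positive all along them. *)
    { pose proof (radial_force_axis_pos n beta r theta ltac:(lia) hbeta
        (conj Hr0 Hr1) (or_introl Hc)). lra. }
    (* On the bisectors the radial force is positive up to [r_l] and negative from [r_u] on, so it
       can vanish only strictly between them. *)
    split; apply Rnot_le_lt; intros H.
    + pose proof (radial_force_axis_pos n beta r theta ltac:(lia) hbeta (conj Hr0 Hr1)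
        (or_intror (conj Hc (le_r_l n beta r hn ltac:(lra) Hr0 H)))). lra.
    + pose proof (radial_force_neg n beta r theta ltac:(lia) ltac:(lra) (conj Hr0 Hr1)
        H Hc). lra.
Qed.
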